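(* Let $d\ge 2$, $q\ge 2$, and let $\mathbb{P}$ be a translation-invariant probability measure on $\Omega=\{0,1,\dots,q-1\}^{\mathbb{Z}^d}$. Suppose that $\mathbb{P}$ has the finite-energy property and the boundary-$1$ Markov property, and that the cluster-size distribution has an exponential tail, i.e. the limit $$\mu=\lim_{n\to\infty}[\mathbb{P}(|C|=n)]^{1/n}=\lim_{n\to\infty}[\mathbb{P}(n\le|C|<\infty)]^{1/n}$$ exists for some $0<\mu\le1$ (both limits exist and are equal). Then $\mu$ also satisfies $$\lim_{n\to\infty}\frac{\mathbb{P}(|C|=n+1)}{\mathbb{P}(|C|=n)}=\lim_{n\to\infty}\frac{\mathbb{P}(n+1\le|C|<\infty)}{\mathbb{P}(n\le|C|<\infty)}=\mu.$$
   Context: Setting: $S=\{0,1,\dots,q-1\}$, $\Omega=S^{\mathbb{Z}^d}$; for $V\subset\mathbb{Z}^d$, $\omega_V$ is the restriction of $\omega\in\Omega$ to $V$. Finite-energy property: there exists $h\in(0,1)$ such that for all $s\in S$, $h\le\inf_{\sigma\in\Omega}\mathbb{P}(\omega(x)=s\mid\omega_{\mathbb{Z}^d\setminus\{x\}}=\sigma_{\mathbb{Z}^d\setminus\{x\}})\le\sup_{\sigma\in\Omega}\mathbb{P}(\omega(x)=s\mid\omega_{\mathbb{Z}^d\setminus\{x\}}=\sigma_{\mathbb{Z}^d\setminus\{x\}})\le 1-h$ (by translation invariance the site $x$ is irrelevant). Boundary-$s$ Markov property ($s\in S$): for finite $V\subset\mathbb{Z}^d$ let $N_V=\bigcup_{x\in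 V}(N_x\setminus V)$, where $N_x=\{y\in\mathbb{Z}^d:|y-x|=1\}$. $\mathbb{P}$ has the boundary-$s$ Markov property if for every finite $V\subset\mathbb{Z}^d$, given that all sites of $N_V$ are in the state $s$, the configuration on $V$ is conditionally independent of the configuration on $\mathbb{Z}^d\setminus(V\cup N_V)$. Clusters: a site $x$ is occupied if $\omega(x)=1$. $C(x)$ is the set of occupied sites that can be connected to $x$ by a nearest-neighbour path in $\mathbb{Z}^d$ passing only through occupied sites; $C(x)=\varnothing$ if $\omega(x)\ne 1$. $C=C(0)$, and $|X|$ is the number of sites of $X$. *)

(* Defs.v *)
From HB Require Import structures.
From mathcomp Require Import all_boot all_order all_algebra.
From mathcomp Require Import all_classical all_reals all_analysis.

Set Implicit Arguments.
Unset Strict Implicit.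
Unset Printing Implicit Defensive.

Import Order.TTheory GRing.Theory Num.Theory.
Import numFieldNormedType.Exports.

Local Open Scope classical_set_scope.
Local Open Scope ring_scope.

Definition site (d : nat) := 'rV[int]_d.

Definition adj (d : nat) (x y : site d) : bool :=
  \sum_(i < d) `|y 0 i - x 0 i| == 1.

Definition nbr_boundary (d : nat) (V : set (site d)) : set (site d) :=
  \bigcup_(x in V) ([set y | adj x y] `\` V).

(* The proof argument only serves to make the state space (hence the
   configuration space) canonically nonempty, as measurableType requires. *)
Definition state (q : nat) (hq : (1 < q)%N) : Type := 'I_q.

HB.instance Definition _ (q : nat) (hq : (1 < q)%N) :=
  Finite.on (state hq).

Definition state1 (q : nat) (hq : (1 < q)%N) : state hq := Ordinal hq.

HB.instance Definition _ (q : nat) (hq : (1 < q)%N) :=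
  isPointed.Build (state hq) (state1 hq).

Definition config (d q : nat) (hq : (1 < q)%N) := site d -> state hq.
HB.instance Definition _ (d q : nat) (hq : (1 < q)%N) :=
  Pointed.on (config d hq).

Definition cylinders (d q : nat) (hq : (1 < q)%N) (V : set (site d)) :
    set (set (config d hq)) :=
  [set A | exists x s, V x /\ A = [set w | w x = s]].
Arguments cylinders {d q} hq V.

(* Sigma-algebra generated by the restriction of w to V. *)
Definition events_on (d q : nat) (hq : (1 < q)%N) (V : set (site d)) :
    set (set (config d hq)) :=
  <<s cylinders hq V >>.
Arguments events_on {d q} hq V.

(* Configurations with the product sigma-algebra. *)
Definition Omega (d q : nat) (hq : (1 < q)%N) :=
  g_sigma_algebraType (cylinders hq [set: site d]).
HB.instance Definition _ (d q : nat) (hq : (1 < q)%N) :=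
  Measurable.on (Omega d hq).

Definition translate (d q : nat) (hq : (1 < q)%N) (a : site d) (w : Omega d hq) :
    Omega d hq :=
  fun x => w (x + a).

Definition translation_invariant (R : realType) (d q : nat) (hq : (1 < q)%N)
    (P : probability (Omega d hq) R) : Prop :=
  forall (a : site d) (A : set (Omega d hq)),
    measurable A -> P (translate a @^-1` A) = P A.

(* f is a version of the conditional probability of E given the
   sub-sigma-algebra F. *)
Definition cond_prob_version (R : realType) (d q : nat) (hq : (1 < q)%N)
    (P : probability (Omega d hq) R) (F : set (set (Omega d hq)))
    (E : set (Omega d hq)) (f : Omega d hq -> R) : Prop :=
  [/\ forall B : set R, measurable B -> F (f @^-1` B),
      P.-integrable [set: Omega d hq] (EFin \o f) &
      forall A, F A -> (\int[P]_(w in A) (f w)%:E)%E = P (A `&` E)].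

(* Conditional probabilities given the configuration off x are only defined
   up to null sets; the bounds are required for all boundary configurations,
   for some version. *)
Definition finite_energy (R : realType) (d q : nat) (hq : (1 < q)%N)
    (P : probability (Omega d hq) R) : Prop :=
  exists h : R, 0 < h < 1 /\
    forall (x : site d) (s : state hq), exists f : Omega d hq -> R,
      [/\ cond_prob_version P (events_on hq (~` [set x]))
            [set w | w x = s] f,
          (h%:E <= ereal_inf [set (f w)%:E | w in [set: Omega d hq]])%E &
          (ereal_sup [set (f w)%:E | w in [set: Omega d hq]] <= (1 - h)%:E)%E].

Definition cond_prob (R : realType) (d q : nat) (hq : (1 < q)%N)
    (P : probability (Omega d hq) R) (A E : set (Omega d hq)) : R :=
  fine (P (A `&` E)) / fine (P E).

Definition boundary_markov (R : realType) (d q : nat) (hq : (1 < q)%N)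
    (P : probability (Omega d hq) R) (s : state hq) : Prop :=
  forall V : set (site d), finite_set V ->
    let E := [set w : Omega d hq | forall y, nbr_boundary V y -> w y = s] in
    forall A B : set (Omega d hq),
      events_on hq V A -> events_on hq (~` (V `|` nbr_boundary V)) B ->
      cond_prob P (A `&` B) E = cond_prob P A E * cond_prob P B E.

Definition occupied (d q : nat) (hq : (1 < q)%N) (w : Omega d hq)
    (x : site d) : bool :=
  w x == state1 hq.

(* The path x :: p includes both endpoints, so the cluster of a site x that is
   not occupied is empty. *)
Definition occ_cluster (d q : nat) (hq : (1 < q)%N) (w : Omega d hq)
    (x : site d) : set (site d) :=
  [set y | exists p : seq (site d),
     [/\ path (@adj d) x p, last x p = y & all (occupied w) (x :: p)]].

Definition prob_size_eq (R : realType) (d q : nat) (hq : (1 < q)%N)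
    (P : probability (Omega d hq) R) (n : nat) : R :=
  fine (P [set w | (occ_cluster w 0 #= `I_n)%card]).

Definition prob_size_ge_fin (R : realType) (d q : nat) (hq : (1 < q)%N)
    (P : probability (Omega d hq) R) (n : nat) : R :=
  fine (P [set w | (`I_n #<= occ_cluster w 0)%card /\ finite_set (occ_cluster w 0)]).

(* Main.v *)
Require Import Defs.
From mathcomp Require Import all_boot all_order all_algebra.
From mathcomp Require Import finmap.
From mathcomp Require Import all_classical all_reals all_analysis.
From mathcomp Require Import ring lra zify.

Import Order.TTheory GRing.Theory Num.Theory.
Import numFieldNormedType.Exports.

Set Implicit Arguments.
Unset Strict Implicit.
Unset Printing Implicit Defensive.

Local Open Scope classical_set_scope.
Local Open Scope ring_scope.

(** The idea is that of Kesten's ratio limit theorem for self-avoiding walks,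
    carried over to clusters by Madras. Write [a n] for the probability of
    cluster size [n], a finite sum of weights [w D = P(C = D)] over the connected
    finite sets [D] of [n] sites that contain the origin.

    Tile the lattice by cubes of side 3, none of which is centred at the origin.
    Call a tile full in [D] if it lies in [D], and pluggable if only its centre is
    missing. Adding or removing the centre of such a tile keeps [D] connected (as
    [d >= 2]), changes its size by one, and multiplies its weight by a constant
    [rho] ([weight_plug]): all neighbours of the centre are occupied, so the state
    of the centre is independent of everything farther away, and translation
    invariance makes [rho] the same for every tile. With [u] full and [v]
    pluggable tiles, counting the pairs (set, marked tile) in two ways expresses
    sums of weights at sizes [n + 1] and [n + 2] as sums at size [n] weighted by
    [r = rho v / (u + 1)] and by nearly [r ^ 2] ([swap_once], [swap_twice]). If [u]
    is of order [n], the error in the second is [O(1/n)], and convexity gives, for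
    [phi n = a (n + 1) / a n],

      [phi n * phi (n + 1) >= phi n ^ 2 - D / n].

    Sets with few full tiles are negligible ([fill_sum], [few_full_doubling]).
    Finite energy allows any [k] tiles met by [D] to be filled at a bounded
    multiplicative cost per tile. There are at least of order [n] tiles to choose
    from, whereas after filling there are at most [2 k] full tiles, so a filled set
    arises from at most [exp(O(k))] choices. When [k] is a small fraction of [n]
    the first count wins by a factor [2 ^ k], and since [a n] has a root limit this
    makes the sets with fewer than [k] full tiles an exponentially small part.

    The displayed inequality forces [phi n] to converge to the root limit
    ([ratio_limit]): it prevents [phi] from decreasing quickly, so one value well
    above [mu] persists forwards, and one well below persists backwards, over a
    window of length proportional to [n], and either would contradict the
    exponential rate. Finally the tail probabilities [b n] satisfy
    [b n = a n + b (n + 1)] and tend to 0, so their ratios are averages of those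
    of [a] ([tail_ratio_limit]). *)

(** * Ratio limits from exponential rates *)

(** The root limit in the multiplicative form in which it is used: all
    estimates compare products of [a n] with powers of [mu], without roots. *)
Definition exp_rate (R : realType) (a : nat -> R) (mu : R) :=
  forall t : R, 1 < t -> exists N, forall n, (N <= n)%N ->
    (mu / t) ^+ n <= a n <= (mu * t) ^+ n.

Lemma exp_rate_root (R : realType) (a : nat -> R) (mu : R) :
  0 < mu -> (forall n, 0 <= a n) ->
  (fun n : nat => a n `^ (n%:R^-1)) @ \oo --> mu -> exp_rate a mu.
Proof.
move=> mu0 a0 cv t t1.
have t0 : 0 < t by apply: lt_trans t1.
have lo : mu / t < mu by rewrite ltr_pdivrMr // ltr_pMr.
have hi : mu < mu * t by rewrite ltr_pMr.
have [N1 _ H1] := cvgr_gt _ cv _ lo.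
have [N2 _ H2] := cvgr_lt _ cv _ hi.
exists (maxn 1 (maxn N1 N2)) => n; rewrite !geq_max => /and3P[n1 nN1 nN2].
have aE : a n = (a n `^ n%:R^-1) ^+ n.
  by rewrite -powR_mulrn ?powR_ge0// -powRrM mulVf ?pnatr_eq0 -?lt0n// powRr1.
have := H1 n nN1; have := H2 n nN2; rewrite /= => L U.
rewrite aE; apply/andP; split; rewrite lerXn2r ?nnegrE ?powR_ge0 ?ltW//.
- by rewrite divr_gt0.
- by rewrite mulr_gt0.
Qed.

Lemma root_above1 (R : realType) (m : nat) (y : R) : 1 < y ->
  exists2 t : R, 1 < t & t ^+ m <= y.
Proof.
move=> y1; have y0 : 0 < y by apply: lt_trans y1.
case: m => [|m]; first by exists y; rewrite ?expr0 ?ltW.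
have tE : (y `^ m.+1%:R^-1) ^+ m.+1 = y.
  by rewrite -powR_mulrn ?powR_ge0// -powRrM mulVf ?pnatr_eq0// powRr1 // ltW.
exists (y `^ m.+1%:R^-1); last by rewrite tE.
rewrite ltNge; apply/negP => t1.
have := exprn_ile1 m.+1 (powR_ge0 y m.+1%:R^-1) t1.
by rewrite tE leNgt y1.
Qed.

Lemma rate_window_leq (L n k : nat) : (0 < L)%N -> (0 < k)%N ->
  (n <= 2 * L * k)%N -> (2 * n + k < 6 * L * k)%N.
Proof.
move=> L0 k0; have : (k <= L * k)%N by rewrite leq_pmull.
rewrite -!mulnA; lia.
Qed.

Lemma leq_twice_divM (L n : nat) : (0 < L)%N -> (L <= n)%N ->
  (n <= 2 * L * (n %/ L))%N.
Proof.
move=> L0 nL; have h := ltn_ceil n L0; rewrite mulSn (mulnC (n %/ L)%N) in h.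
have : (L <= L * (n %/ L))%N by rewrite leq_pmulr // divn_gt0.
by rewrite -mulnA mul2n -addnn; move: h; lia.
Qed.

(** A window of length [k] proportional to [n] is long enough for an exponential
    factor with the wrong base to beat the subexponential error in [exp_rate]. *)
Lemma exp_rate_gap (R : realType) (a : nat -> R) (mu w z : R) (L : nat) :
  0 < mu -> exp_rate a mu -> 0 < w < mu -> mu < z -> (0 < L)%N ->
  exists N, forall n k, (N <= n)%N -> (0 < k)%N -> (n <= 2 * L * k)%N ->
    w ^+ k * a n < a (n + k)%N < z ^+ k * a n.
Proof.
move=> mu0 ra /andP[w0 wmu] muz L0.
have z0 : 0 < z by apply: lt_trans muz.
pose y := Num.min (mu / w) (z / mu).
have y1 : 1 < y by rewrite /y lt_min ltr_pdivlMr // mul1r wmu ltr_pdivlMr // mul1r.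
have y0 : 0 < y by apply: lt_trans y1.
have yw : y * w <= mu by rewrite -ler_pdivlMr // /y ge_min lexx.
have yz : mu * y <= z by rewrite mulrC -ler_pdivlMr // /y ge_min lexx orbT.
have [t t1 ty] := root_above1 (6 * L) y1.
have t0 : 0 < t by apply: lt_trans t1.
have [N HN] := ra t t1.
exists (maxn N 1) => n k; rewrite geq_max => /andP[Nn n0] k0 nk.
have /andP[l1 u1] := HN n Nn.
have /andP[l2 u2] := HN (n + k)%N (leq_trans Nn (leq_addr _ _)).
have Ty : t ^+ (2 * n + k) < y ^+ k.
  apply: (@lt_le_trans _ _ (t ^+ (6 * L * k))); last first.
    by rewrite exprM lerXn2r // nnegrE ?exprn_ge0 ?ltW.
  by rewrite ltr_eXn2l // rate_window_leq.
have tn0 : 0 < t ^+ n by rewrite exprn_gt0.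
have mun : 0 < mu ^+ n by rewrite exprn_gt0.
have muk : 0 < mu ^+ k by rewrite exprn_gt0.
have TE : t ^+ (2 * n + k) = t ^+ n * t ^+ n * t ^+ k by rewrite mul2n -addnn !exprD.
have tk0 : 0 < t ^+ k by rewrite exprn_gt0.
apply/andP; split.
- apply: (@le_lt_trans _ _ (w ^+ k * (mu * t) ^+ n)).
    by rewrite ler_wpM2l // exprn_ge0 // ltW.
  apply: lt_le_trans l2.
  rewrite -(ltr_pM2r (exprn_gt0 (n + k) t0)) -exprMn divfK ?gt_eqF// exprMn !exprD.
  have -> : w ^+ k * (mu ^+ n * t ^+ n) * (t ^+ n * t ^+ k) =
            mu ^+ n * (w ^+ k * t ^+ (2 * n + k)) by rewrite TE; ring.
  rewrite ltr_pM2l //; apply: (@lt_le_trans _ _ (w ^+ k * y ^+ k)).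
    by rewrite ltr_pM2l // exprn_gt0.
  by rewrite -exprMn mulrC lerXn2r // nnegrE ltW // mulr_gt0.
- apply: (@lt_le_trans _ _ (z ^+ k * (mu / t) ^+ n)); last first.
    by rewrite ler_wpM2l // exprn_ge0 // ltW.
  apply: le_lt_trans u2 _.
  rewrite -(ltr_pM2r tn0) -[ltRHS]mulrA -exprMn divfK ?gt_eqF// exprMn !exprD.
  have -> : mu ^+ n * mu ^+ k * (t ^+ n * t ^+ k) * t ^+ n =
            mu ^+ n * (mu ^+ k * t ^+ (2 * n + k)) by rewrite TE; ring.
  rewrite [ltRHS]mulrC ltr_pM2l //.
  apply: (@lt_le_trans _ _ (mu ^+ k * y ^+ k)); first by rewrite ltr_pM2l.
  by rewrite -exprMn lerXn2r // nnegrE ltW // mulr_gt0.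
Qed.

Lemma exp_rate_gt0 (R : realType) (a : nat -> R) (mu : R) :
  0 < mu -> exp_rate a mu -> exists N, forall n, (N <= n)%N -> 0 < a n.
Proof.
move=> mu0 /(_ 2 (ltr1n R 2)) [N HN]; exists N => n /HN /andP[+ _].
by apply: lt_le_trans; rewrite exprn_gt0 // divr_gt0.
Qed.

(** If [phi n >= mu + e], the inequality lets [phi] drop by at most
    [D / (n * mu)] per step, so [phi >= mu + e / 2] on a window of length
    [n / L]; then [a] grows too fast there. *)
Lemma ratio_eventually_lt (R : realType) (a : nat -> R) (mu D e : R) (N0 : nat) :
  0 < mu -> exp_rate a mu -> 0 <= D -> 0 < e ->
  (forall n, (N0 <= n)%N ->
    (a n.+1 / a n) ^+ 2 - D / n%:R <= a n.+1 / a n * (a n.+2 / a n.+1)) ->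
  exists N, forall n, (N <= n)%N -> a n.+1 / a n < mu + e.
Proof.
move=> mu0 ra D0 e0 Hphi.
have [N1 apos] := exp_rate_gt0 mu0 ra.
pose L := (Num.truncn (2 * D / (mu * e))).+1.
have LD : 2 * D / (mu * e) <= L%:R by rewrite ltW // truncnS_gt.
have gap : mu / 2 < mu < mu + e / 2 by apply/andP; split; lra.
have [gap1 gap2] := andP gap.
have hmu : 0 < mu / 2 < mu by rewrite gap1 divr_gt0.
have [N2 Hgap] := exp_rate_gap mu0 ra hmu gap2 (ltn0Sn _ : (0 < L)%N).
exists (maxn (maxn N0 N1) (maxn N2 L)) => n.
rewrite !geq_max => /andP[/andP[nN0 nN1] /andP[nN2 nL]].
have n0 : (0 < n)%N by apply: leq_trans nL.
have n0R : 0 < n%:R :> R by rewrite ltr0n.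
rewrite ltNge; apply/negP => big.
set k := (n %/ L)%N.
have k0 : (0 < k)%N by rewrite divn_gt0.
have slack (j : nat) : (j <= k)%N -> j%:R * (D / (n%:R * mu)) <= e / 2.
  move=> jk.
  have jL : j%:R * L%:R <= n%:R :> R.
    by rewrite -natrM ler_nat; apply: leq_trans (leq_divM n L); rewrite leq_mul.
  rewrite mulrA ler_pdivrMr ?mulr_gt0 //.
  have := LD; rewrite ler_pdivrMr ?mulr_gt0 // => LD'.
  have j0 : 0 <= j%:R :> R by [].
  have h1 : j%:R * (2 * D) <= j%:R * (L%:R * (mu * e)) by rewrite ler_wpM2l.
  have h2 : j%:R * L%:R * (mu * e) <= n%:R * (mu * e).
    by rewrite ler_wpM2r // mulr_ge0 // ltW.
  rewrite mulrA in h1; nra.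
have prop (j : nat) : (j <= k)%N ->
    mu + e - j%:R * (D / (n%:R * mu)) <= a (n + j).+1 / a (n + j)%N.
  elim: j => [|j IH] jk; first by rewrite mul0r subr0 addn0.
  have {}IH := IH (ltnW jk); have sj := slack j (ltnW jk).
  have := Hphi (n + j)%N (leq_trans nN0 (leq_addr _ _)).
  rewrite addnS; set p := _ / a (n + j)%N in IH *; set p' := _ / a _.+1.
  have pm : mu <= p by lra.
  have p0 : 0 < p by lra.
  move=> Hp.
  have : p - D / (n%:R * mu) <= p'.
    rewrite -(ler_pM2l p0) mulrBr -expr2; apply: le_trans Hp.
    rewrite lerB //.
    apply: (@le_trans _ _ (D / n%:R)).
      rewrite ler_wpM2l // lef_pV2 ?posrE ?ltr0n ?addn_gt0 ?n0 //.
      by rewrite ler_nat leq_addr.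
    have -> : p * (D / (n%:R * mu)) = D / n%:R * (p / mu).
      by field; rewrite !gt_eqF.
    rewrite ler_peMr //; first by rewrite divr_ge0 // ltW.
    by rewrite ler_pdivlMr // mul1r.
  rewrite -natr1 mulrDl mul1r; lra.
have grow (j : nat) : (j <= k)%N -> (mu + e / 2) ^+ j * a n <= a (n + j)%N.
  elim: j => [|j IH] jk; first by rewrite expr0 mul1r addn0.
  have {}IH := IH (ltnW jk); have sj := slack j (ltnW jk).
  have := prop j (ltnW jk).
  have aj : 0 < a (n + j)%N by apply: apos; apply: leq_trans nN1 (leq_addr _ _).
  move=> pj; have : mu + e / 2 <= a (n + j).+1 / a (n + j)%N by lra.
  rewrite ler_pdivlMr // => qj.
  rewrite addnS exprS -mulrA; apply: le_trans qj.
  by rewrite ler_wpM2l //; lra.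
have nk : (n <= 2 * L * k)%N by apply: leq_twice_divM.
have /andP[_] := Hgap n k nN2 k0 nk.
by rewrite ltNge grow.
Qed.

(** The mirror image: reading the inequality backwards, a value below [mu - e] was
    already below [mu - e / 2] throughout the preceding window. The bound on the
    increment needs [phi] bounded below, but where [phi <= mu / 2] there is
    nothing to prove; this is what [e <= mu / 2] is for. *)
Lemma ratio_eventually_gt (R : realType) (a : nat -> R) (mu D e : R) (N0 : nat) :
  0 < mu -> exp_rate a mu -> 0 <= D -> 0 < e <= mu / 2 ->
  (forall n, (N0 <= n)%N ->
    (a n.+1 / a n) ^+ 2 - D / n%:R <= a n.+1 / a n * (a n.+2 / a n.+1)) ->
  exists N, forall n, (N <= n)%N -> mu - e < a n.+1 / a n.
Proof.
move=> mu0 ra D0 /andP[e0 emu] Hphi.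
have [N1 apos] := exp_rate_gt0 mu0 ra.
pose L := (Num.truncn (8 * D / (mu * e))).+2.
have LD : 8 * D / (mu * e) <= L%:R.
  by apply: (le_trans (ltW (truncnS_gt _))); rewrite ler_nat.
have hw : 0 < mu - e / 2 < mu by apply/andP; split; lra.
have hz : mu < mu + 1 by lra.
have [N2 Hgap] := exp_rate_gap mu0 ra hw hz (ltn0Sn _ : (0 < L)%N).
exists (maxn (2 * maxn N0 N1).+2 (maxn (2 * N2) L)) => n.
rewrite !geq_max => /andP[nN01 /andP[nN2 nL]].
have n0 : (0 < n)%N by apply: leq_trans nL.
have n0R : 0 < n%:R :> R by rewrite ltr0n.
rewrite ltNge; apply/negP => small.
set k := (n %/ L)%N.
have k0 : (0 < k)%N by rewrite divn_gt0.
have kn2 : (2 * k <= n)%N.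
  by apply: leq_trans (leq_divM n L); rewrite mulnC leq_mul.
have half (j : nat) : (j <= k)%N -> (n <= 2 * (n - j))%N by lia.
have slack (j : nat) : (j <= k)%N -> j%:R * (4 * D / (n%:R * mu)) <= e / 2.
  move=> jk.
  have jL : j%:R * L%:R <= n%:R :> R.
    by rewrite -natrM ler_nat; apply: leq_trans (leq_divM n L); rewrite leq_mul.
  rewrite mulrA ler_pdivrMr ?mulr_gt0 //.
  have := LD; rewrite ler_pdivrMr ?mulr_gt0 // => LD'.
  have j0 : 0 <= j%:R :> R by [].
  have h1 : j%:R * (8 * D) <= j%:R * (L%:R * (mu * e)) by rewrite ler_wpM2l.
  have h2 : j%:R * L%:R * (mu * e) <= n%:R * (mu * e).
    by rewrite ler_wpM2r // mulr_ge0 // ltW.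
  rewrite mulrA in h1; nra.
have E0 : 0 <= 4 * D / (n%:R * mu) by rewrite !(mulr_ge0, invr_ge0) // ltW.
have big (j : nat) : (j <= k)%N -> (maxn N0 N1 <= n - j)%N.
  move=> /half; move: nN01; clear; lia.
have prop (j : nat) : (j <= k)%N ->
    a (n - j).+1 / a (n - j)%N <= mu - e + j%:R * (4 * D / (n%:R * mu)).
  elim: j => [|j IH] jk; first by rewrite mul0r addr0 subn0.
  have {}IH := IH (ltnW jk).
  have njE : (n - j = (n - j.+1).+1)%N by move: jk kn2 k0; clear; lia.
  have := big _ jk; rewrite geq_max => /andP[b0 b1].
  have := Hphi (n - j.+1)%N b0; rewrite -njE.
  set q := a (n - j).+1 / _ in IH *; set p := _ / a _ => Hp.
  rewrite -natr1 mulrDl mul1r; set E := 4 * D / _ in IH E0 *.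
  have jE : 0 <= j%:R * E by rewrite mulr_ge0.
  have [pm|pm] := leP p (mu / 2); first by lra.
  have p0 : 0 < p by apply: lt_trans pm; rewrite divr_gt0.
  suff : p - E <= q by lra.
  rewrite -(ler_pM2l p0) mulrBr -expr2; apply: le_trans Hp; rewrite lerB //.
  apply: (@le_trans _ _ (2 * D / n%:R)).
    rewrite [2 * D]mulrC -mulrA ler_wpM2l // -[leLHS]mul1r.
    rewrite ler_pdivrMr; last first.
      by rewrite ltr0n; move: (half _ jk) n0; clear; lia.
    rewrite mulrAC ler_pdivlMr // mul1r -natrM ler_nat.
    exact: half.
  have EE : E = 2 * D / n%:R * (2 / mu) by rewrite /E invfM; field; rewrite !gt_eqF.
  rewrite EE mulrCA ler_peMr //; first by rewrite !(mulr_ge0, invr_ge0) // ltW.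
  by rewrite mulrA ler_pdivlMr // mul1r; lra.
have pos (j : nat) : (j <= k)%N -> 0 < a (n - j)%N.
  by move=> /big; rewrite geq_max => /andP[_ /apos].
have decay (j : nat) : (j <= k)%N -> a n <= (mu - e / 2) ^+ j * a (n - j)%N.
  elim: j => [|j IH] jk; first by rewrite expr0 mul1r subn0.
  have {}IH := IH (ltnW jk); have sj := slack _ jk; have pj := prop _ jk.
  have njE : (n - j = (n - j.+1).+1)%N by move: jk kn2 k0; clear; lia.
  have : a (n - j)%N / a (n - j.+1)%N <= mu - e / 2 by rewrite njE; lra.
  rewrite ler_pdivrMr ?pos // => qj.
  apply: (le_trans IH); rewrite exprSr -mulrA ler_wpM2l // exprn_ge0 //; lra.
have nk : (n - k <= 2 * L * k)%N.
  by apply: leq_trans (leq_subr _ _) _; exact: leq_twice_divM.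
have nkN : (N2 <= n - k)%N by move: nN2 (half k (leqnn k)); clear; lia.
have := Hgap (n - k)%N k nkN k0 nk.
rewrite subnK; last by move: kn2; clear; lia.
by rewrite ltNge decay.
Qed.

Lemma ratio_limit (R : realType) (a : nat -> R) (mu D : R) (N0 : nat) :
  0 < mu -> exp_rate a mu -> 0 <= D ->
  (forall n, (N0 <= n)%N ->
    (a n.+1 / a n) ^+ 2 - D / n%:R <= a n.+1 / a n * (a n.+2 / a n.+1)) ->
  (fun n => a n.+1 / a n) @ \oo --> mu.
Proof.
move=> mu0 ra D0 Hphi; apply/cvgrPdist_lt => e e0.
pose e' := Num.min e (mu / 2).
have e'0 : 0 < e' by rewrite lt_min e0 divr_gt0.
have e'mu : 0 < e' <= mu / 2 by rewrite e'0 /= /e' ge_min lexx orbT.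
have e'e : e' <= e by rewrite /e' ge_min lexx.
have [N1 H1] := ratio_eventually_lt mu0 ra D0 e0 Hphi.
have [N2 H2] := ratio_eventually_gt mu0 ra D0 e'mu Hphi.
exists (maxn N1 N2) => // n; rewrite /= geq_max => /andP[n1 n2].
by have := H1 n n1; have := H2 n n2; rewrite ltr_distlC => h1 h2; apply/andP; split; lra.
Qed.

(** By telescoping, [b n.+1 - mu * b n] is the sum of [a m.+1 - mu * a m] over
    [m >= n], each term of which is at most [e * a m]. *)
Lemma tail_ratio_limit (R : realType) (a b : nat -> R) (mu : R) (N0 : nat) :
  0 < mu -> (forall n, 0 <= b n) ->
  (forall n, (N0 <= n)%N -> 0 < a n /\ b n = a n + b n.+1) ->
  b @ \oo --> 0 ->
  (fun n => a n.+1 / a n) @ \oo --> mu ->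
  (fun n => b n.+1 / b n) @ \oo --> mu.
Proof.
move=> mu0 b0 Hab cb ca; apply/cvgrPdist_le => e e0.
have e20 : 0 < e / 2 by rewrite divr_gt0.
have /cvgrPdist_le /(_ _ e20) [N1 _ HN1] := ca.
exists (maxn N0 N1) => // n; rewrite /= geq_max => /andP[nN0 nN1].
have [an bn] := Hab n nN0.
have bn0 : 0 < b n by rewrite bn ltr_pwDl.
have step (M : nat) :
  `|(b n.+1 - mu * b n) - (b (n + M).+1 - mu * b (n + M)%N)| <=
    e / 2 * (b n - b (n + M)%N).
  elim: M => [|M IH]; first by rewrite addn0 !subrr normr0 mulr0.
  have nM : (N0 <= n + M)%N by apply: leq_trans nN0 (leq_addr _ _).
  have nM1 : (N1 <= n + M)%N by apply: leq_trans nN1 (leq_addr _ _).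
  have [aM bM] := Hab _ nM.
  have [aM' bM'] := Hab (n + M).+1 (leqW nM).
  have := HN1 _ nM1; rewrite /= ler_distlC => /andP[].
  rewrite ler_pdivlMr // => h1; rewrite ler_pdivrMr // => h2.
  rewrite addnS; move: IH; rewrite !ler_norml => /andP[i1 i2].
  apply/andP; split; nra.
pose dl := e / 2 * b n / (1 + mu).
have dl0 : 0 < dl by rewrite divr_gt0 ?mulr_gt0 // ltr_pwDl // ltW.
have /cvgrPdist_le /(_ _ dl0) [N2 _ HN2] := cb.
have bM : b (n + N2)%N <= dl.
  have := HN2 (n + N2)%N (leq_addl _ _).
  by rewrite /= sub0r normrN ger0_norm.
have [aM bME] := Hab (n + N2)%N (leq_trans nN0 (leq_addr _ _)).
have dlE : (1 + mu) * dl = e / 2 * b n.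
  by rewrite /dl mulrC divfK // gt_eqF // ltr_pwDl // ltW.
have bM0 := b0 (n + N2)%N; have bM1 := b0 (n + N2).+1.
have := step N2.
rewrite ler_distlC => /andP[s1 s2].
rewrite ler_distlC; apply/andP; split.
  rewrite ler_pdivlMr //; nra.
rewrite ler_pdivrMr //; nra.
Qed.

(** A part [bad] of [a] that stays below the sum of [a] over the sizes from [n] to
    [2 n] even after multiplication by [2 ^ (n / L)] is exponentially small relative
    to [a]: as [mu <= 1], larger sizes do not have larger rates. Only the bound
    [C / n] is recorded, which is what the ratio inequality can absorb. *)
Lemma ratio_of_doubling (R : realType) (a bad : nat -> R) (mu : R) (L : nat) :
  0 < mu <= 1 -> exp_rate a mu -> (0 < L)%N ->
  (forall n, (0 < n)%N ->
     2 ^+ (n %/ L) * bad n <= \sum_(i < n.+1) a (n + i)%N) ->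
  exists C, 0 <= C /\ exists N, forall n, (N <= n)%N -> bad n <= C / n%:R * a n.
Proof.
move=> /andP[mu0 mu1] ra L0 Hbad.
(* 32/25 = 2 / (5/4)^2: Bernoulli's inequality for each factor 5/4 then
   supplies two powers of 1/k, one of which pays for the n + 1 summands. *)
have h1 : 1 < 32 / 25 :> R by lra.
have [t t1 tL] := root_above1 (6 * L) h1.
have t0 : 0 < t by apply: lt_trans t1.
have [N HN] := ra t t1.
exists (128 * L%:R ^+ 2); split; first by rewrite mulr_ge0 // exprn_ge0.
exists (maxn N L) => n; rewrite geq_max => /andP[nN nL].
have n0 : (0 < n)%N by apply: leq_trans nL.
have := Hbad n n0; set k := (n %/ L)%N => Hb.
have k0 : (0 < k)%N by rewrite divn_gt0.
have nk : (n <= 2 * L * k)%N by apply: leq_twice_divM.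
have /andP[an _] := HN n nN.
have a0 : 0 < a n by apply: lt_le_trans an; rewrite exprn_gt0 // divr_gt0.
have term (i : 'I_n.+1) : a (n + i)%N <= (32 / 25) ^+ k * a n.
  have /andP[_ ui] := HN (n + i)%N (leq_trans nN (leq_addr _ _)).
  apply: (le_trans ui).
  apply: (@le_trans _ _ ((32 / 25) ^+ k * (mu / t) ^+ n)); last first.
    by rewrite ler_wpM2l // exprn_ge0 //; lra.
  have tn0 : 0 < t ^+ n by rewrite exprn_gt0.
  rewrite -(ler_pM2r tn0) -[leRHS]mulrA -exprMn divfK ?gt_eqF// exprMn.
  rewrite mulrC mulrCA mulrC.
  apply: (@le_trans _ _ ((t ^+ n * t ^+ (n + i)) * mu ^+ n)).
    apply: ler_wpM2l; first by rewrite mulr_ge0 ?exprn_ge0 // ltW.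
    by rewrite exprD ler_piMr ?exprn_ge0 ?exprn_ile1 // ltW.
  apply: ler_wpM2r; first by rewrite exprn_ge0 // ltW.
  apply: (@le_trans _ _ (t ^+ (6 * L * k))).
    rewrite -exprD ler_eXn2l //.
    have := ltn_ord i; move: nk; rewrite -!mulnA; clear; lia.
  by rewrite exprM lerXn2r // nnegrE ?exprn_ge0 // ?ltW //; lra.
have {}Hb : 2 ^+ k * bad n <= n.+1%:R * ((32 / 25) ^+ k * a n).
  apply: (le_trans Hb); apply: le_trans (ler_sum _ (fun i _ => term i)) _.
  by rewrite sumr_const card_ord -[leLHS]mulr_natl.
have Hb2 : (5 / 4) ^+ k * (5 / 4) ^+ k * bad n <= n.+1%:R * a n.
  rewrite -(ler_pM2l (exprn_gt0 k (lt_trans ltr01 h1))).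
  apply: le_trans (le_trans Hb _); last by rewrite mulrCA.
  rewrite 2!mulrA -!exprMn.
  by have -> : 32 / 25 * (5 / 4) * (5 / 4) = 2 :> R by lra.
have B5 : k%:R / 4 <= (5 / 4) ^+ k :> R.
  clear; elim: k => [|k IH]; first by rewrite mul0r expr0.
  have : 1 <= (5 / 4) ^+ k :> R by rewrite exprn_ege1 //; lra.
  rewrite exprS -[k.+1%:R]natr1; lra.
have k0R : 0 < k%:R / 4 :> R by rewrite divr_gt0 ?ltr0n.
have [bneg|bpos] := leP (bad n) 0.
  by apply: (le_trans bneg); rewrite !mulr_ge0 ?invr_ge0 ?exprn_ge0 // ltW.
have Hb3 : (k%:R / 4) * (k%:R / 4) * bad n <= n.+1%:R * a n.
  apply: le_trans Hb2; apply: ler_wpM2r; first exact: ltW.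
  by apply: ler_pM => //; exact: ltW.
have n0R : 0 < n%:R :> R by rewrite ltr0n.
have nkR : n%:R <= 2 * L%:R * k%:R :> R by rewrite -!natrM ler_nat.
rewrite mulrAC ler_pdivlMr //.
rewrite -(ler_pM2l n0R).
have e1 : n%:R * n%:R <= (2 * L%:R * k%:R) * (2 * L%:R * k%:R) :> R.
  by rewrite ler_pM.
have e2 : n.+1%:R <= 2 * n%:R :> R by rewrite -natrM ler_nat; move: n0; clear; lia.
have e3 : n%:R * (bad n * n%:R) <= (2 * L%:R * k%:R) * (2 * L%:R * k%:R) * bad n.
  by rewrite mulrCA mulrC ler_wpM2r // ltW.
apply: (le_trans e3).
have -> : (2 * L%:R * k%:R) * (2 * L%:R * k%:R) * bad n =
   64 * L%:R ^+ 2 * ((k%:R / 4) * (k%:R / 4) * bad n) by field.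
apply: (@le_trans _ _ (64 * L%:R ^+ 2 * (2 * n%:R * a n))); last first.
  by rewrite le_eqVlt; apply/orP; left; apply/eqP; ring.
apply: ler_wpM2l; first by rewrite mulr_ge0 // exprn_ge0.
by apply: (le_trans Hb3); rewrite ler_wpM2r // ltW.
Qed.

(** * The lattice and its tiling by cubes of side 3 *)

Section Geometry.
Variable d : nat.
Implicit Types (x y z b : site d) (D E X : {fset site d}).

Definition cube n : {fset site d} :=
  [fset \row_i ((f i : nat)%:Z - n%:Z)
    | f : {ffun 'I_d -> 'I_(2 * n).+1} in {ffun 'I_d -> 'I_(2 * n).+1}]%fset.

Lemma mem_cube n x : (x \in cube n) = [forall i, `|x 0 i| <= n%:Z].
Proof.
apply/imfsetP/forallP => [[f _ ->] i|xn].
  by rewrite mxE; case: (f i) => m /= mn; lia.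
exists [ffun i : 'I_d => inord (absz (x 0 i + n%:Z)%R)] => //.
by apply/rowP => i; rewrite mxE ffunE inordK; have := xn i; move: (x 0 i) => c; lia.
Qed.

Lemma cube_gt0 n : (0 < #|` cube n|)%N.
Proof.
rewrite cardfs_gt0; apply/fset0Pn; exists 0; rewrite mem_cube.
by apply/forallP => i; rewrite mxE normr0.
Qed.

Lemma adj_sym x y : adj x y = adj y x.
Proof. by rewrite /adj; congr (_ == _); apply: eq_bigr => i _; rewrite distrC. Qed.

Lemma adj_addr z x y : adj (x + z) (y + z) = adj x y.
Proof.
by rewrite /adj; congr (_ == _); apply: eq_bigr => i _; rewrite !mxE; congr `|_|; ring.
Qed.

Lemma adj_addl z x y : adj (z + x) (z + y) = adj x y.
Proof. by rewrite ![z + _]addrC adj_addr. Qed.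

Lemma adj0B x y : adj x y = adj 0 (y - x).
Proof. by rewrite -(adj_addr x 0) add0r subrK. Qed.

Lemma adj0P z : reflect (exists i (s : int), `|s| = 1 /\ z = s *: delta_mx 0 i) (adj 0 z).
Proof.
apply: (iffP eqP) => [|[i [s [s1 ->]]]].
  under eq_bigr do rewrite mxE subr0.
  move=> z1; have [i zi] : exists i, z 0 i != 0.
    apply: contrapT => nz; move: z1; rewrite big1 // => i _.
    by have [->|zi] := eqVneq (z 0 i) 0; [rewrite normr0 | case: nz; exists i].
  exists i, (z 0 i); move: z1; rewrite (bigD1 i) //= => z1.
  set S := \sum_(j | _) _ in z1.
  have S0 : 0 <= S by apply: sumr_ge0.
  have [zi1 SE] : `|z 0 i| = 1 /\ S = 0 by lia.
  split=> //; apply/rowP => j; rewrite !mxE eqxx /=.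
  have [->|ji] := eqVneq j i; first by rewrite mulr1.
  move/eqP: SE; rewrite /S psumr_eq0 // => /allP /(_ j).
  by rewrite mem_index_enum ji normr_eq0 mulr0 => /(_ isT) /eqP.
rewrite (bigD1 i) //= big1 => [|j ji].
  by rewrite addr0 !mxE !eqxx subr0 mulr1 s1.
by rewrite !mxE eqxx (negbTE ji) mulr0 subr0 normr0.
Qed.

Definition nbr x : {fset site d} := [fset (x + z)%R | z in cube 1 & adj 0%R z]%fset.

Lemma adj_cube1 z : adj 0 z -> z \in cube 1.
Proof.
move=> /adj0P[i [s [s1 ->]]]; rewrite mem_cube; apply/forallP => j.
by rewrite !mxE normrM s1 mul1r; case: (_ && _).
Qed.

Lemma mem_nbr x y : (y \in nbr x) = adj x y.
Proof.
apply/imfsetP/idP => [[z /=]|xy].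
  by rewrite inE => /andP[_ z1 ->]; rewrite -[x in adj x _]addr0 adj_addl.
have z1 : adj 0 (y - x) by rewrite -adj0B.
by exists (y - x); rewrite ?addrNK ?[x + _]addrC ?addrNK // inE /= adj_cube1.
Qed.

Lemma adj_irr x : adj x x = false.
Proof. by rewrite /adj big1 // => i _; rewrite subrr normr0. Qed.

(** The tile with index [b] is the cube of side 3 around [3 b + (1, ..., 1)]; this
    offset keeps the origin away from all centres. *)
Definition tile z : site d := \row_i divz (z 0 i) 3.
Definition centre b : site d := \row_i (3 * b 0 i + 1).
Definition cell b : {fset site d} := [fset (centre b + z)%R | z in cube 1]%fset.

Lemma mem_cell b z : (z \in cell b) = (tile z == b).
Proof.
apply/imfsetP/eqP => [[y /=]|<-].
  rewrite mem_cube => /forallP y1 ->; apply/rowP => i; rewrite !mxE.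
  by have := y1 i; move: (b 0 i) (y 0 i) => u v; lia.
exists (z - centre (tile z)); last by rewrite addrC subrK.
rewrite /= mem_cube; apply/forallP => i; rewrite !mxE.
by move: (z 0 i) => u; lia.
Qed.

Lemma card_cell b : #|` cell b| = #|` cube 1|.
Proof. by rewrite card_imfset //; exact: addrI. Qed.

Lemma centre_cell b : centre b \in cell b.
Proof.
by rewrite mem_cell; apply/eqP/rowP => i; rewrite !mxE; move: (b 0 i) => u; lia.
Qed.

Lemma tile_centre b : tile (centre b) = b.
Proof. by apply/eqP; rewrite -mem_cell centre_cell. Qed.

Lemma adj_cell b z : adj (centre b) z -> z \in cell b.
Proof.
rewrite adj0B => /adj_cube1 zb; apply/imfsetP; exists (z - centre b) => //=.
by rewrite addrC subrK.
Qed.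

Lemma punctured_nbr b z : adj (centre b) z -> z \in (cell b `\ centre b)%fset.
Proof.
move=> cz; rewrite in_fsetD1 adj_cell // andbT.
by apply/eqP => zc; move: cz; rewrite zc adj_irr.
Qed.

Lemma centre_neq0 b : (0 < d)%N -> centre b != 0.
Proof.
move=> d0; apply/eqP => /rowP/(_ (Ordinal d0)); rewrite !mxE; move: (b 0 _) => u; lia.
Qed.

End Geometry.

(** * Connectivity inside finite sets and tiles *)

Section Connectivity.
Variable d : nat.
Implicit Types (x y z b : site d) (D E X : {fset site d}).

Definition conn D x y := exists p : seq (site d),
  [/\ path (@adj d) x p, last x p = y & all (mem D) (x :: p)].

Lemma conn_refl D x : x \in D -> conn D x x.
Proof. by move=> xD; exists [::]; rewrite /= xD. Qed.

Lemma conn_trans D x y z : conn D x y -> conn D y z -> conn D x z.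
Proof.
move=> [p [pp <- pD]] [q [qp <- qD]]; exists (p ++ q).
rewrite cat_path pp qp last_cat; split=> //.
by move: pD qD; rewrite /= all_cat => /andP[-> ->] /andP[_ ->].
Qed.

Lemma conn_adj D x y : x \in D -> y \in D -> adj x y -> conn D x y.
Proof. by move=> xD yD xy; exists [:: y]; rewrite /= xy xD yD. Qed.

Lemma conn_last D x y : conn D x y -> y \in D.
Proof. by move=> [p [_ <- /allP pD]]; apply: pD; exact: mem_last. Qed.

Lemma conn_head D x y : conn D x y -> x \in D.
Proof. by move=> [p [_ _ /= /andP[]]]. Qed.

Lemma conn_ind D x (Q : site d -> Prop) : x \in D -> Q x ->
  (forall y z, conn D x y -> Q y -> z \in D -> adj y z -> Q z) ->
  forall y, conn D x y -> Q y.
Proof.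
move=> xD Qx step y [p [pp <- pD]] {y}.
elim/last_ind: p pp pD => [|p z IH] //.
rewrite rcons_path last_rcons /= all_rcons => /andP[pp az] /and3P[xD' zD pD].
have pD' : all (mem D) (x :: p) by rewrite /= xD' pD.
by apply: (step (last x p)) => //; [exists p | exact: IH].
Qed.

Lemma conn_sym D x y : conn D x y -> conn D y x.
Proof.
move=> h; have xD := conn_head h; move: y h; apply: conn_ind => //.
  exact: conn_refl.
move=> y z xy yx zD yz; apply: conn_trans yx; apply: conn_adj => //.
  exact: conn_last xy.
by rewrite adj_sym.
Qed.

Lemma conn_sub D E x y : {subset D <= E} -> conn D x y -> conn E x y.
Proof.
move=> DE [p [pp pl /allP pD]]; exists p; split => //.
by apply/allP => z /pD /DE.
Qed.

Definition animal D := 0 \in D /\ forall y, y \in D -> conn D 0 y.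

(** Resetting to the centre one coordinate in which [y] differs from it moves to an
    adjacent site of the same tile. *)
Lemma cell_conn b y : y \in cell b -> conn (cell b) (centre b) y.
Proof.
have [n] := ubnP #|[pred i | y 0 i != centre b 0 i]|.
elim: n => // n IH in y *; rewrite ltnS => yn yb.
have [i yi|yc] := pickP [pred i | y 0 i != centre b 0 i]; last first.
  have -> : y = centre b.
    by apply/rowP => i; have := yc i; move/negbFE/eqP.
  exact/conn_refl/centre_cell.
pose z : site d := \row_j (if j == i then centre b 0 j else y 0 j).
have zb : z \in cell b.
  move: yb; rewrite !mem_cell => /eqP yb; apply/eqP/rowP => j.
  rewrite mxE [z 0 j]mxE; case: eqP => _; last by rewrite -yb mxE.
  by have := tile_centre b => /rowP/(_ j); rewrite mxE.
have zy : adj z y.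
  rewrite adj0B; apply/adj0P; exists i, (y 0 i - centre b 0 i); split.
    move: yb yi; rewrite mem_cell /= => /eqP/rowP/(_ i); rewrite !mxE.
    by move: (y 0 i) (b 0 i) => u v; lia.
  apply/rowP => j; rewrite !mxE eqxx /=.
  by case: eqVneq => [->|_]; rewrite ?mulr1 ?mulr0 ?subrr.
apply: (@conn_trans _ _ z); last exact: conn_adj.
apply: IH => //; apply: leq_trans yn.
apply: proper_card; apply/properP; split.
  apply/fintype.subsetP => j; rewrite !inE mxE; case: ifP => // /eqP ->.
  by rewrite eqxx.
by exists i; rewrite !inE // mxE eqxx eqxx.
Qed.

Lemma cell_conn2 b x y : x \in cell b -> y \in cell b -> conn (cell b) x y.
Proof.
by move=> xb yb; apply: (@conn_trans _ _ (centre b)); [apply: conn_sym|]; exact: cell_conn.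
Qed.

(** Two neighbours of the centre in different coordinate directions have a common
    second neighbour, at a corner of the unit square that they span with the
    centre. If the directions agree, a third neighbour in another direction serves
    as intermediate stop; this is where [d >= 2] is used. *)
Lemma punctured_conn b x y (D := (cell b `\ centre b)%fset) : (1 < d)%N ->
  adj (centre b) x -> adj (centre b) y -> conn D x y.
Proof.
move=> d1.
have inD u v : adj (centre b) u -> adj (centre b) v ->
    (forall i (s t : int), u - centre b = s *: delta_mx 0 i ->
       v - centre b <> t *: delta_mx 0 i) -> conn D u v.
  move=> cu cv indep.
  have nD w : adj (centre b) w -> w \in D by exact: punctured_nbr.
  have wD : u + (v - centre b) \in D.
    move: cu cv; rewrite !(adj0B (centre b)).
    move=> /adj0P[i [s [s1 ui]]] /adj0P[j [t [t1 vj]]].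
    have ij : i != j by apply/eqP => ij; apply: (indep i s t) => //; rewrite ij.
    have -> : u + (v - centre b) = centre b + (s *: delta_mx 0 i + t *: delta_mx 0 j).
      by rewrite -ui -vj [RHS]addrA; congr (_ + _); rewrite addrC subrK.
    rewrite /D in_fsetD1; apply/andP; split.
      apply/eqP => /(congr1 (fun m : site d => (m - centre b) 0 i)).
      rewrite [centre b + _]addrC addrK subrr !mxE !eqxx (negbTE ij) /=.
      by move: s1; clear; lia.
    apply/imfsetP; eexists; last by reflexivity.
    rewrite /= mem_cube; apply/forallP => k; rewrite !mxE !eqxx /=.
    have [->|ki] := eqVneq k i.
      by rewrite (negbTE ij); move: s1; clear; lia.
    by rewrite mulr0 add0r; case: (_ == _); move: t1; clear; lia.
  apply: (@conn_trans _ _ (u + (v - centre b))); apply: conn_adj => //; try exact: nD.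
    by rewrite -[u in adj u _]addr0 adj_addl -adj0B.
  rewrite adj_sym.
  have -> : u + (v - centre b) = v + (u - centre b) by rewrite addrCA.
  by rewrite -[v in adj v _]addr0 adj_addl -adj0B.
move=> cx cy.
have := cx; have := cy; rewrite !(adj0B (centre b)).
move=> /adj0P[j [t [t1 yj]]] /adj0P[i [s [s1 xi]]].
have dE k l (a c : int) : k != l -> `|a| = 1 ->
    a *: delta_mx 0 k <> c *: delta_mx 0 l :> site d.
  move=> kl a1 /rowP/(_ k); rewrite !mxE !eqxx (negbTE kl) /=.
  by move: a1; clear; lia.
have dE2 k l u v : k != l -> `|u| = 1 -> `|v| = 1 -> forall m (a c : int),
   u *: delta_mx 0 k = a *: delta_mx 0 m :> site d ->
   v *: delta_mx 0 l <> c *: delta_mx 0 m :> site d.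
  move=> kl u1 v1 m a c; have [mk|km] := eqVneq k m; last by move=> /(dE _ _ _ _ km u1).
  by move=> _; apply: (dE l m v c _ v1); rewrite eq_sym -mk.
have [ij|ij] := eqVneq i j; last first.
  by apply: inD => // k a c; rewrite xi yj; exact: dE2.
have [k ki] : exists k : 'I_d, k != i.
  have [/eqP i0|i0] := boolP (val i == 0)%N.
    by exists (Ordinal d1); rewrite -val_eqE /= i0.
  by exists (Ordinal (ltnW d1)); rewrite -val_eqE /= eq_sym.
pose w : site d := centre b + 1 *: delta_mx 0 k.
have cw : adj (centre b) w.
  by rewrite -[x in adj x _]addr0 adj_addl; apply/adj0P; exists k, 1.
have wE : w - centre b = 1 *: delta_mx 0 k by rewrite /w addrC addKr.
apply: (@conn_trans _ _ w); apply: inD => // m a c; rewrite wE.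
  by rewrite xi; apply: dE2 => //; rewrite eq_sym.
by rewrite yj; apply: dE2 => //; rewrite -ij.
Qed.

End Connectivity.

(** * Lattice animals, plugging and filling *)

Section Animals.
Variable d : nat.
Hypothesis d1 : (1 < d)%N.
Implicit Types (x y z b : site d) (D E X : {fset site d}).
Local Open Scope fset_scope.

Definition animals n : {fset {fset site d}} :=
  [fset D in fpowerset (cube d n) | `[< animal D >] && (#|` D| == n)%N].

(** A duplicate-free path inside [D] has fewer than [#|` D|] steps; hence the cube
    in the definition of [animals] is large enough. *)
Lemma animal_cube D : animal D -> D `<=` cube d #|` D|.
Proof.
move=> [_ aD]; apply/fsubsetP => y /aD [p [pp <- pD]] {y}.
case/shortenP: pp pD => p' pp' up' sub pD.
have p'D : all (mem D) (0%R :: p').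
  apply/allP => z; rewrite inE => /orP[/eqP ->|/sub zp]; move/allP: pD; apply.
    by rewrite inE eqxx.
  by rewrite inE zp orbT.
have sz : (size p' < #|` D|)%N.
  by have := uniq_leq_size up' (allP p'D); rewrite /= .
rewrite mem_cube; apply/forallP => i.
apply: (@le_trans _ _ (size p')%:Z); last by rewrite lez_nat ltnW.
clear -pp'; elim/last_ind: p' pp' => [|p z IH]; first by rewrite /= mxE.
rewrite rcons_path last_rcons size_rcons => /andP[/IH {}IH]; rewrite adj0B.
have -> : z 0%R i = (last 0 p 0 i + (z - last 0 p) 0 i)%R.
  by rewrite !mxE addrC subrK.
move=> /adj_cube1; rewrite mem_cube => /forallP/(_ i).
by move: (_ 0%R i) IH (_ 0%R i) => u; lia.
Qed.

Lemma mem_animals n D : reflect (animal D /\ #|` D| = n) (D \in animals n).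
Proof.
rewrite !inE /=; apply: (iffP idP).
  by move=> /andP[_ /andP[/asboolP aD /eqP]].
move=> [aD Dn]; rewrite fpowersetE -Dn animal_cube //= eqxx andbT.
exact/asboolP.
Qed.

Definition cells X : {fset site d} := \bigcup_(b <- X) cell b.
Definition tiles D : {fset site d} := [fset tile z | z in D].

Lemma mem_cells X z : (z \in cells X) = (tile z \in X).
Proof.
apply/bigfcupP/idP => [[b]|zX].
  by rewrite andbT mem_cell => bX /eqP ->.
by exists (tile z); rewrite ?zX // mem_cell.
Qed.

Lemma mem_tiles D b : reflect (exists2 z, z \in D & z \in cell b) (b \in tiles D).
Proof.
apply: (iffP (imfsetP _ _ _ _)) => [[z zD ->]|[z zD]].
  by exists z; rewrite ?mem_cell.
by rewrite mem_cell => /eqP <-; exists z.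
Qed.

Lemma card_cells X : (#|` cells X| <= #|` cube d 1| * #|` X|)%N.
Proof.
rewrite /cells; elim/finSet_rect: X => X IH.
have [->|[b bX]] := fset_0Vmem X; first by rewrite big_seq_fset0 cardfs0.
rewrite (big_fsetD1 b) //= (cardfsD1 b X) bX mulnDr muln1.
apply: leq_trans (leq_card_fsetU _ _) _; rewrite card_cell leq_add2l.
by apply: IH; rewrite fproperD1.
Qed.

Lemma card_tiles D : (#|` D| <= #|` cube d 1| * #|` tiles D|)%N.
Proof.
apply: leq_trans (card_cells _); apply: fsubset_leq_card; apply/fsubsetP => z zD.
by rewrite mem_cells; apply/imfsetP; exists z.
Qed.

Lemma fill_animal D X : animal D -> X `<=` tiles D -> animal (D `|` cells X).
Proof.
move=> [D0 aD] /fsubsetP XD; split; first by rewrite inE D0.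
have sD : {subset D <= D `|` cells X} by move=> z zD; rewrite inE zD.
move=> y; rewrite inE => /orP[/aD|]; first exact: conn_sub.
rewrite mem_cells => yX; have /mem_tiles[z zD zy] := XD _ yX.
apply: (@conn_trans _ _ _ z); first exact: conn_sub (aD _ zD).
apply: (@conn_sub _ (cell (tile y))); last by apply: cell_conn2; rewrite // mem_cell.
by move=> u; rewrite mem_cell inE mem_cells => /eqP ->; rewrite yX orbT.
Qed.

Definition full D : {fset site d} := [fset b in tiles D | cell b `<=` D].
Definition pluggable D : {fset site d} :=
  [fset b in tiles D | (cell b `\ centre b `<=` D) && (centre b \notin D)].

Lemma centre_nbr b : exists2 z, adj (centre b) z & z \in cell b `\ centre b.
Proof.
have d0 := ltnW d1.
pose z := (centre b + 1 *: delta_mx 0 (Ordinal d0))%R.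
have cz : adj (centre b) z.
  rewrite -[x in adj x _]addr0 adj_addl; apply/adj0P.
  by exists (Ordinal d0), 1%R.
by exists z => //; exact: punctured_nbr.
Qed.

Lemma mem_full D b : (b \in full D) = (cell b `<=` D).
Proof.
rewrite !inE /=; apply: andb_idl => /fsubsetP bD; apply/mem_tiles.
by exists (centre b); rewrite ?bD ?centre_cell.
Qed.

Lemma mem_pluggable D b :
  (b \in pluggable D) = (cell b `\ centre b `<=` D) && (centre b \notin D).
Proof.
rewrite !inE /=; apply: andb_idl => /andP[/fsubsetP bD _]; apply/mem_tiles.
have [z _ zb] := centre_nbr b; exists z; first exact: bD.
by move: zb; rewrite in_fsetD1 => /andP[].
Qed.

Lemma card_pluggable D : (#|` pluggable D| <= #|` D|)%N.
Proof.
apply: (@leq_trans #|` tiles D|); last exact: leq_imfset_card.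
by apply: fsubset_leq_card; apply/fsubsetP => b; rewrite !inE => /andP[].
Qed.

Lemma centre_in_cell b c : (centre b \in cell c) = (b == c).
Proof. by rewrite mem_cell tile_centre. Qed.

Lemma plug_full D b : b \in pluggable D -> full (centre b |` D) = b |` full D.
Proof.
rewrite mem_pluggable => /andP[/fsubsetP bD bnD]; apply/fsetP => c.
rewrite in_fset1U !mem_full; apply/fsubsetP/orP => [cD|[/eqP ->|/fsubsetP cD] z zc].
- have [->|cb] := eqVneq c b; [by left|right]; apply/fsubsetP => z zc.
  have := cD z zc; rewrite !inE => /orP[/eqP zb|//].
  by move: zc; rewrite zb centre_in_cell eq_sym (negbTE cb).
- rewrite !inE; have [//|zb] := eqVneq z (centre b).
  by rewrite bD // !inE zb.
- by rewrite !inE cD // orbT.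
Qed.

Lemma plug_pluggable D b : b \in pluggable D -> pluggable (centre b |` D) = pluggable D `\ b.
Proof.
move=> bv; have := bv; rewrite mem_pluggable => /andP[/fsubsetP bD bnD]; apply/fsetP => c.
rewrite in_fsetD1 !mem_pluggable; have [->|cb] := eqVneq c b; first by rewrite !inE eqxx andbF.
rewrite /=; congr (_ && _); last first.
  rewrite !inE negb_or; have -> : centre c != centre b by
    apply: contra_neq cb => /(congr1 (@tile d)); rewrite !tile_centre.
  by [].
apply/fsubsetP/fsubsetP => cD z zc; have := cD z zc; last by rewrite !inE => ->; rewrite orbT.
rewrite !inE => /orP[/eqP zb|//].
by move: zc; rewrite !inE zb centre_in_cell [b == c]eq_sym (negbTE cb) andbF.
Qed.

Lemma plug_card D b : b \in pluggable D -> #|` centre b |` D| = (#|` D|).+1.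
Proof. by rewrite mem_pluggable => /andP[_ bD]; rewrite cardfsU1 bD. Qed.

Lemma plug_animal D b : animal D -> b \in pluggable D -> animal (centre b |` D).
Proof.
move=> [D0 aD]; rewrite mem_pluggable => /andP[/fsubsetP bD bnD].
split; first by rewrite !inE D0 orbT.
have sD : {subset D <= centre b |` D} by move=> z zD; rewrite !inE zD orbT.
move=> y; rewrite !inE => /orP[/eqP ->|/aD]; last exact: conn_sub.
have [z cz /bD zD] := centre_nbr b.
apply: conn_trans (conn_sub sD (aD _ zD)) _.
by apply: conn_adj; [exact: sD | rewrite !inE eqxx | rewrite adj_sym].
Qed.

(** A path through the removed centre enters and leaves it by neighbours, which
    stay connected in the punctured tile. In the induction along a path, [Q z]
    says that [z] is reached, or, if [z] is the missing centre, that all its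
    neighbours are. *)
Lemma unplug_animal D b : animal D -> b \in full D -> animal (D `\ centre b).
Proof.
move=> [D0 aD]; rewrite mem_full => /fsubsetP bD; set D' := D `\ centre b.
have O' : 0%R \in D' by rewrite !inE D0 eq_sym centre_neq0 // ltnW.
split=> // y yD'; have yD : y \in D by move: yD'; rewrite !inE => /andP[].
have sub : {subset cell b `\ centre b <= D'}.
  by move=> z; rewrite !inE => /andP[-> /bD].
have nD z : adj (centre b) z -> z \in D' by move=> /punctured_nbr/sub.
pose Q z := if z == centre b then forall n, adj (centre b) n -> conn D' 0 n
            else conn D' 0 z.
suff : Q y by rewrite /Q; move: yD'; rewrite in_fsetD1 => /andP[/negbTE ->].
have := aD y yD; apply: conn_ind => //.
  by rewrite /Q eq_sym (negbTE (centre_neq0 _ (ltnW d1))); exact: conn_refl.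
move=> u v _ Qu vD uv; move: Qu; rewrite /Q.
have [uc|uc] := eqVneq u (centre b); have [vc|vc] := eqVneq v (centre b) => //.
- by apply; rewrite -uc.
- move=> cu n bn; apply: (conn_trans cu); apply: (conn_sub sub).
  by apply: punctured_conn => //; rewrite -vc adj_sym.
- move=> cu; apply: (conn_trans cu); apply: conn_adj => //; first exact: conn_last cu.
  by rewrite !inE vc.
Qed.

Lemma unplug_pluggable D b : b \in full D -> b \in pluggable (D `\ centre b).
Proof.
rewrite mem_full mem_pluggable !inE eqxx /= => bD; rewrite andbT.
exact: fsetSD.
Qed.

Lemma fill_full D X : X `<=` full (D `|` cells X).
Proof.
apply/fsubsetP => b bX; rewrite mem_full; apply/fsubsetP => z.
by rewrite mem_cell inE mem_cells => /eqP ->; rewrite bX orbT.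
Qed.

Lemma full_fill D X : full (D `|` cells X) `<=` full D `|` X.
Proof.
apply/fsubsetP => b; rewrite in_fsetU !mem_full => /fsubsetP bD.
have [bX|bX] := boolP (b \in X); first by rewrite orbT.
rewrite orbF; apply/fsubsetP => z zb.
have := bD z zb; rewrite inE mem_cells => /orP[//|].
by move: zb; rewrite mem_cell => /eqP ->; rewrite (negbTE bX).
Qed.

End Animals.

(** * Counting *)

Lemma ksub_card (K : choiceType) (T : {fset K}) (k : nat) :
  ('C(#|` T|, k) <= #|` [fset X in fpowerset T | #|` X| == k]%fset|)%N.
Proof.
have -> : #|` T| = #|{: T}| by rewrite cardfE.
rewrite -card_draws cardE.
pose g (A : {set T}) : {fset K} := [fset val x | x in A]%fset.
have mg (A : {set T}) (x : T) : (val x \in g A) = (x \in A).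
  apply/imfsetP/idP => [[y /= yA /val_inj ->]//|xA]; by exists x.
have ginj : injective g.
  by move=> A B AB; apply/setP => x; rewrite -!mg AB.
rewrite -(size_map g); apply: uniq_leq_size.
  by rewrite map_inj_uniq // enum_uniq.
move=> X /mapP[A]; rewrite mem_enum inE => /eqP Ak ->.
rewrite !inE /= fpowersetE; apply/andP; split.
  by apply/fsubsetP => y /imfsetP[x /= _ ->]; exact: valP.
by rewrite card_imfset -?Ak ?cardE //; exact: val_inj.
Qed.

Lemma leq_bin_exp (j k : nat) : (0 < j)%N -> (j ^ k <= 'C(j * k, k))%N.
Proof.
move=> j0; elim: k => [|k IH]; first by rewrite bin0.
rewrite -(@leq_pmul2l k.+1) // -mul_bin_diag expnS mulnA [(k.+1 * j)%N]mulnC.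
rewrite leq_mul // (leq_trans IH) //.
rewrite leq_bin2l //; have : (0 < j * k.+1)%N by rewrite muln_gt0 j0.
by rewrite mulnS; move: j0; clear; lia.
Qed.

(** [s] is a list with repetitions: this bounds a sum over choices by a sum over
    their outcomes. *)
Lemma sum_multiplicity (R : realFieldType) (T : eqType) (w : T -> R) (s Q : seq T)
    (M : nat) :
  (forall x, 0 <= w x) -> {subset s <= Q} ->
  (forall x, (count_mem x s <= M)%N) ->
  \sum_(x <- s) w x <= M%:R * \sum_(x <- Q) w x.
Proof.
move=> w0 sQ cM.
apply: (@le_trans _ _ (M%:R * \sum_(x <- undup Q) w x)); last first.
  rewrite ler_wpM2l //; elim: Q {sQ} => //= x Q IH; rewrite big_cons.
  by case: ifP => _; rewrite ?big_cons ?lerD2l // (le_trans IH) // lerDr.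
have -> : \sum_(x <- s) w x = \sum_(y <- undup Q) (count_mem y s)%:R * w y.
  transitivity (\sum_(x <- s) \sum_(y <- undup Q) (x == y)%:R * w y).
    rewrite big_seq [RHS]big_seq; apply: eq_bigr => x xs.
    rewrite (bigD1_seq x) ?mem_undup ?sQ ?undup_uniq //= eqxx mul1r big1 ?addr0 // => y.
    by rewrite eq_sym => /negbTE ->; rewrite mul0r.
  rewrite exchange_big /=; apply: eq_bigr => y _; rewrite -mulr_suml; congr (_ * _).
  by rewrite -sum1_count natr_sum [RHS]big_mkcond; apply: eq_bigr => x _ /=; case: eqP.
by rewrite mulr_sumr ler_sum // => y _; rewrite ler_wpM2r // ler_nat.
Qed.

Section Sums.
Variables (R : realFieldType) (d : nat).
Hypothesis d1 : (1 < d)%N.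
Implicit Types (x y z b : site d) (D E X : {fset site d}).
Variables (w : {fset site d} -> R).
Hypothesis w0 : forall D, 0 <= w D.

Definition nfull D := #|` full D|.
Definition npluggable D := #|` pluggable D|.

(** Both sides sum over the pairs of an animal and a marked tile: plugging the
    marked tile is a bijection from animals of size [n] with a pluggable tile to
    animals of size [n.+1] with a full tile. It turns one pluggable tile into a
    full one and leaves all other tiles alone, as tiles are disjoint. *)
Lemma swap_sum (rho : R) (f : nat -> nat -> R) n :
  (forall D b, animal D -> b \in pluggable D -> w (centre b |` D)%fset = rho * w D) ->
  \sum_(D <- animals d n) rho * w D * (npluggable D)%:R * f (nfull D).+1 (npluggable D).-1 =
  \sum_(D <- animals d n.+1) w D * (nfull D)%:R * f (nfull D) (npluggable D).
Proof.
move=> hsw.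
have sumE (A B : {fset site d}) (c : R) : #|` A|%:R * c = \sum_(b <- A) c.
  by rewrite big_const_seq count_predT iter_addr addr0 mulr_natl.
pose G D := w D * f (nfull D) (npluggable D).
pose s1 := [seq ((centre b |` D)%fset, b) | D <- animals d n, b <- pluggable D].
pose s2 := [seq (D, b) | D <- animals d n.+1, b <- full D].
transitivity (\sum_(p <- s1) G p.1).
  rewrite big_allpairs_dep /= big_seq [RHS]big_seq; apply: eq_bigr => D.
  move=> /mem_animals[aD Dn].
  rewrite [in LHS]mulrAC mulrC /npluggable sumE // big_seq [RHS]big_seq; apply: eq_bigr => b bv.
  rewrite /G hsw // /nfull /npluggable plug_full // plug_pluggable // cardfsU1.
  rewrite (cardfsD1 b (pluggable D)) bv add1n /=; congr (_ * f _ _).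
  rewrite (_ : _ \notin _) //; rewrite mem_full //.
  by move: bv; rewrite mem_pluggable // => /andP[_];
    apply: contra => /fsubsetP; apply; exact: centre_cell.
transitivity (\sum_(p <- s2) G p.1); last first.
  rewrite big_allpairs_dep /=; apply: eq_bigr => D _.
  by rewrite mulrAC mulrC /nfull sumE.
apply: perm_big; apply: uniq_perm.
- apply: allpairs_uniq_dep; [exact: fset_uniq|by move=> D _; exact: fset_uniq|].
  move=> [D b] [D' b'] /allpairsPdep[E [c [_ cE [-> ->]]]].
  move=> /allpairsPdep[E' [c' [_ cE' [-> ->]]]] /= [EE cc]; rewrite -cc in cE' EE *.
  move: cE cE'; rewrite !mem_pluggable // => /andP[_ cE] /andP[_ cE'].
  suff -> : E = E' by [].
  by rewrite -(fsetU1K cE) EE; exact: fsetU1K.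
- apply: allpairs_uniq_dep; [exact: fset_uniq|by move=> D _; exact: fset_uniq|].
  by move=> [D b] [D' b'] _ _ [-> ->].
move=> [D b]; apply/allpairsPdep/allpairsPdep => [[E [c [/mem_animals[aE En] cE [-> ->]]]]|].
  exists (centre c |` E)%fset, c; split => //; last first.
    by rewrite plug_full // !inE eqxx.
  apply/mem_animals; split; first exact: plug_animal.
  by rewrite plug_card // En.
move=> [E [c [/mem_animals[aE En] cE [-> ->]]]].
have cE' : centre c \in E.
  by move: cE; rewrite mem_full // => /fsubsetP; apply; exact: centre_cell.
exists (E `\ centre c)%fset, c; split.
- apply/mem_animals; split; first exact: unplug_animal.
  by move: En; rewrite (cardfsD1 (centre c)) cE' => -[].
- exact: unplug_pluggable.
- by rewrite fsetD1K.
Qed.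

(** Fill [k] of the tiles that [D] meets. The left-hand side counts the choices:
    [D] meets at least [j * k] tiles, hence there are at least [j ^ k] choices, each
    costing [kappa ^ k]. On the right, the filled set [E] has at most [2 k] full
    tiles, and [D] together with the choice [X] is recovered from [E], [X] and the
    trace of [D] on the filled tiles: at most [2 ^ (2 k)] possibilities for [X]
    and [2 ^ (2 k * #|cube|)] for the trace. *)
Lemma fill_sum (kappa : R) (j n k : nat) :
  0 < kappa -> (0 < j)%N -> (#|` cube d 1| * (j * k) <= n)%N ->
  (forall D X, animal D -> (X `<=` tiles D)%fset ->
     kappa ^+ #|` X| * w D <= w (D `|` cells X)%fset) ->
  (j%:R * kappa) ^+ k * \sum_(D <- animals d n | (nfull D < k)%N) w D <=
  (2 ^ (2 * k * (#|` cube d 1|).+1))%:R *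
    \sum_(i < (#|` cube d 1| * k).+1) \sum_(D <- animals d (n + i)) w D.
Proof.
set s := #|` cube d 1|; move=> k0 j0 nk hfill.
pose sub D : {fset {fset site d}} := [fset X in fpowerset (tiles D) | #|` X| == k]%fset.
pose bad := [seq D <- animals d n | (nfull D < k)%N].
pose prs := [seq (D, X) | D <- bad, X <- sub D].
pose ps := [seq (p.1 `|` cells p.2)%fset | p <- prs].
pose U := [seq D | i <- iota 0 (s * k).+1, D <- enum_fset (animals d (n + i))].
have inprs p : p \in prs ->
    [/\ animal p.1, #|` p.1| = n, (nfull p.1 < k)%N,
        (p.2 `<=` tiles p.1)%fset & #|` p.2| = k].
  move=> /allpairsPdep[D [X [+ + ->]]] /=.
  rewrite mem_filter => /andP[Dk /mem_animals[aD Dn]].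
  by rewrite !inE /= fpowersetE => /andP[XD /eqP Xk].
have psU : {subset ps <= U}.
  move=> E /mapP[[D X] /inprs[/= aD Dn Dk XD Xk] ->].
  have nE : (n <= #|` (D `|` cells X)%fset|)%N.
    by rewrite -Dn; apply: fsubset_leq_card; exact: fsubsetUl.
  have Es : (#|` (D `|` cells X)%fset| <= n + s * k)%N.
    apply: leq_trans (leq_card_fsetU _ _) _; rewrite Dn leq_add2l -Xk.
    exact: card_cells.
  apply/allpairsPdep; exists (#|` (D `|` cells X)%fset| - n)%N, (D `|` cells X)%fset.
  split=> //; first by rewrite mem_iota; move: nE Es; clear; lia.
  by apply/mem_animals; split; [exact: fill_animal | rewrite subnKC].
have psM E : (count_mem E ps <= 2 ^ (2 * k * s.+1))%N.
  pose tgt := [seq (X, Y) | X <- fpowerset (full E), Y <- fpowerset (cells (full E))].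
  pose g (p : {fset site d} * {fset site d}) := (p.2, (p.1 `&` cells p.2)%fset).
  have [->|] := eqVneq (count_mem E ps) 0%N; first by [].
  rewrite -lt0n -has_count.
  move=> /hasP[E' /mapP[[D0 X0] /inprs[/= aD0 D0n D0k XD0 X0k] ->] /eqP E0].
  have fE : (#|` full E| <= 2 * k)%N.
    rewrite -E0; apply: leq_trans (fsubset_leq_card (full_fill _ _)) _.
    apply: leq_trans (leq_card_fsetU _ _) _; rewrite X0k mul2n -addnn leq_add2r.
    exact: ltnW.
  have -> : count_mem E ps = size [seq p <- prs | (p.1 `|` cells p.2)%fset == E].
    by rewrite count_map size_filter.
  rewrite -(size_map g); apply: (@leq_trans (size tgt)); last first.
    rewrite size_allpairs !card_fpowerset -expnD leq_exp2l //.
    apply: (@leq_trans (#|` full E| + s * #|` full E|)%N).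
      by rewrite leq_add2l card_cells.
    by rewrite -mulSn mulnC leq_mul2r fE orbT.
  apply: uniq_leq_size.
    rewrite map_inj_in_uniq ?filter_uniq //.
      apply: allpairs_uniq_dep; [exact/filter_uniq/fset_uniq| |].
        by move=> D _; exact: fset_uniq.
      by move=> [D b] [D' b'] _ _ [-> ->].
    move=> [D X] [D' X']; rewrite !mem_filter /= => /andP[/eqP DE _] /andP[/eqP DE' _].
    rewrite /g /= => -[XX DD]; rewrite -XX in DD DE' *; congr (_, _).
    apply/fsetP => z; have [zX|zX] := boolP (z \in cells X).
      by move/fsetP: DD => /(_ z); rewrite !inE zX !andbT.
    have : (z \in D `|` cells X)%fset = (z \in D' `|` cells X)%fset by rewrite DE DE'.
    by rewrite !inE (negbTE zX) !orbF.
  move=> q /mapP[[D X]]; rewrite mem_filter => /andP[/eqP /= DE /inprs[/= aD Dn Dk XD Xk]] ->.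
  have XE : (X `<=` full E)%fset by rewrite -DE; exact: fill_full.
  apply/allpairsP; exists (X, (D `&` cells X)%fset) => /=; rewrite !fpowersetE; split=> //.
  apply: fsubset_trans (fsubsetIr _ _) _.
  by apply/fsubsetP => z; rewrite !mem_cells; apply/fsubsetP.
have low : (j%:R * kappa) ^+ k * \sum_(D <- animals d n | (nfull D < k)%N) w D <=
   \sum_(E <- ps) w E.
  rewrite big_map big_allpairs_dep /= -big_filter mulr_sumr.
  rewrite big_seq [leRHS]big_seq; apply: ler_sum => D Db.
  have [aD Dn] : animal D /\ #|` D| = n.
    by move: Db; rewrite mem_filter => /andP[_ /mem_animals].
  apply: (@le_trans _ _ (\sum_(X <- sub D) kappa ^+ k * w D)); last first.
    rewrite big_seq [leRHS]big_seq; apply: ler_sum => X.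
    by rewrite !inE /= fpowersetE => /andP[XD /eqP <-]; exact: hfill.
  rewrite big_const_seq count_predT iter_addr addr0 exprMn -mulrA -[leRHS]mulr_natl.
  apply: ler_wpM2r; first by rewrite mulr_ge0 // exprn_ge0 // ltW.
  rewrite -natrX ler_nat; apply: leq_trans (leq_bin_exp k j0) _.
  apply: leq_trans (ksub_card _ _).
  rewrite leq_bin2l // -(@leq_pmul2l s); last exact: cube_gt0.
  by apply: leq_trans nk _; rewrite -Dn; exact: card_tiles.
apply: (le_trans low); apply: le_trans (sum_multiplicity w0 psU psM) _.
rewrite ler_wpM2l //.
rewrite -(big_mkord xpredT (fun i => \sum_(D <- animals d (n + i)) w D)) /index_iota subn0.
by rewrite big_allpairs_dep.
Qed.

End Sums.

(** * The ratio theorem for weighted animals *)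

(** The second-order transfer factor differs from the square of the first-order
    one by [O(1/n)] as soon as [u] is at least of order [n]. *)
Lemma swap_rate_bounds (R : realFieldType) (rho : R) (u v n L K : nat) :
  0 < rho -> (0 < K)%N -> (0 < n)%N -> (K <= u.+1)%N -> (v <= n)%N -> (n <= 2 * L * K)%N ->
  let r := rho * v%:R / u.+1%:R in
  r <= rho * (2 * L%:R) /\
  r ^+ 2 - rho ^+ 2 * (2 * L%:R) ^+ 2 * (2 * L%:R + 1) / n%:R <=
    rho * v%:R * (rho * v.-1%:R) / (u.+2%:R * u.+1%:R).
Proof.
move=> rho0 K0 n0 Ku vn nK r.
have l0 : 0 <= 2 * L%:R :> R by rewrite mulr_ge0.
set l := 2 * L%:R in l0 *.
have nR : 0 < n%:R :> R by rewrite ltr0n.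
have -> : u.+2%:R = u.+1%:R + 1 :> R by rewrite natr1.
have yK : K%:R <= u.+1%:R :> R by rewrite ler_nat.
have y0 : 0 < u.+1%:R :> R by rewrite ltr0n.
set y := u.+1%:R in y0 yK r *.
have xn : v%:R <= n%:R :> R by rewrite ler_nat.
have nl : n%:R <= l * K%:R by rewrite /l -!natrM ler_nat.
have -> : rho * v%:R * (rho * v.-1%:R) / ((y + 1) * y) =
          rho * v%:R * (rho * (v%:R - 1)) / ((y + 1) * y).
  by congr (_ / _); case: (v) => [|v'] /=; rewrite ?mulr0 ?mul0r // -natr1 addrK.
have x0 : 0 <= v%:R :> R by [].
rewrite /r; set x := v%:R in x0 xn *.
have nly : n%:R <= l * y by apply: (le_trans nl); rewrite ler_wpM2l.
have xy : x / y <= l by rewrite ler_pdivrMr // (le_trans xn).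
have xy0 : 0 <= x / y by rewrite divr_ge0 // ltW.
split; first by rewrite -mulrA ler_wpM2l // ltW.
rewrite lerBlDr -lerBlDl.
have y10 : 0 < y + 1 by rewrite ltr_pwDr.
have -> : (rho * x / y) ^+ 2 - rho * x * (rho * (x - 1)) / ((y + 1) * y) =
   rho ^+ 2 * ((x / y) * (x / y + 1) * (y + 1)^-1).
  by field; rewrite !gt_eqF.
have -> : rho ^+ 2 * l ^+ 2 * (l + 1) / n%:R = rho ^+ 2 * (l * (l + 1) * (l / n%:R)).
  by ring.
apply: ler_wpM2l; first by rewrite exprn_ge0 // ltW.
have h1 : (x / y) * (x / y + 1) <= l * (l + 1).
  by apply: ler_pM => //; rewrite ?addr_ge0 // lerD2r.
have h2 : (y + 1)^-1 <= l / n%:R.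
  rewrite ler_pdivlMr // mulrC ler_pdivrMr //.
  by apply: (le_trans nly); rewrite ler_wpM2l // lerDl.
by apply: ler_pM => //; rewrite ?mulr_ge0 ?addr_ge0 // invr_ge0 ltW.
Qed.

Section AbstractRatio.
Variables (R : realType) (d : nat).
Hypothesis d1 : (1 < d)%N.
Implicit Types (D X : {fset site d}).
Variables (w : {fset site d} -> R) (rho kappa mu : R).
Hypothesis w0 : forall D, 0 <= w D.
Hypothesis rho0 : 0 < rho.
Hypothesis kappa0 : 0 < kappa.
Hypothesis mu01 : 0 < mu <= 1.
Hypothesis hsw : forall D b, animal D -> b \in pluggable D ->
  w (centre b |` D)%fset = rho * w D.
Hypothesis hfill : forall D X, animal D -> (X `<=` tiles D)%fset ->
  kappa ^+ #|` X| * w D <= w (D `|` cells X)%fset.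

Let a n := \sum_(D <- animals d n) w D.

Lemma animal_weight_ge0 n : 0 <= a n.
Proof. exact: sumr_ge0. Qed.

(** The base [j] of the count of choices can be taken as large as desired by
    letting [k] be a smaller fraction of [n]; it is chosen to beat the cost of
    filling and the number of preimages, with a factor 2 per tile to spare. *)
Lemma few_full_doubling : exists2 L : nat, (0 < L)%N & forall n,
  2 ^+ (n %/ L) * \sum_(D <- animals d n | (nfull D < n %/ L)%N) w D <=
  \sum_(i < n.+1) a (n + i)%N.
Proof.
set s := #|` cube d 1|.
pose M : R := 2 * 4 ^+ s.+1.
pose j := (Num.truncn (M / kappa)).+1.
have jM : M <= j%:R * kappa by rewrite -ler_pdivrMr // ltW // truncnS_gt.
have s0 : (0 < s)%N by exact: cube_gt0.
exists (s * j)%N; first by rewrite muln_gt0 s0.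
move=> n; set k := (n %/ (s * j))%N.
have kn : (s * (j * k) <= n)%N by rewrite mulnA mulnC leq_divM.
set bad := \sum_(D <- _ | _) _.
have bad0 : 0 <= bad by apply: sumr_ge0.
have := fill_sum w0 kappa0 (ltn0Sn _ : (0 < j)%N) kn hfill; rewrite -/s -/bad => H.
have Mk : 0 < (4 ^+ s.+1 : R) ^+ k by rewrite !exprn_gt0.
rewrite -(ler_pM2l Mk); apply: (@le_trans _ _ ((j%:R * kappa) ^+ k * bad)).
  rewrite mulrA ler_wpM2r // -exprMn mulrC lerXn2r // nnegrE ?mulr_ge0 ?exprn_ge0 ?ltW //.
apply: (le_trans H).
have -> : (2 ^ (2 * k * s.+1))%:R = (4 ^+ s.+1 : R) ^+ k.
  have -> : 4 = 2 ^+ 2 :> R by rewrite -natrX.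
  by rewrite natrX -!exprM mulnAC -mulnA.
rewrite ler_pM2l // -!(big_mkord xpredT (fun i => a (n + i)%N)).
have sk : (s * k <= n)%N.
  by apply: leq_trans kn; rewrite leq_mul2l leq_pmull // orbT.
rewrite (big_cat_nat (n := (s * k).+1) (m := 0) (p := n.+1)) //=.
by rewrite lerDl; apply: sumr_ge0 => i _; exact: animal_weight_ge0.
Qed.

(** Dividing by the number of full tiles turns the marked count of [swap_sum] into
    a plain one. *)
Lemma swap_once m n :
  \sum_(D <- animals d n.+1 | (m < nfull D)%N) w D =
  \sum_(D <- animals d n | (m <= nfull D)%N) w D * (rho * (npluggable D)%:R / (nfull D).+1%:R).
Proof.
have := swap_sum d1 (fun u _ => (m < u)%N%:R / u%:R) n hsw => H.
rewrite [RHS]big_mkcond [LHS]big_mkcond /=.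
transitivity (\sum_(D <- animals d n.+1) w D * (nfull D)%:R *
  ((m < nfull D)%N%:R / (nfull D)%:R)).
  apply: eq_bigr => D _; case: ltnP => h; last by rewrite mul0r mulr0.
  by rewrite mul1r mulfK // pnatr_eq0 -lt0n; apply: leq_ltn_trans h.
rewrite -H; apply: eq_bigr => D _; rewrite ltnS.
by case: leqP => _; rewrite ?mul0r ?mulr0 // mul1r; ring.
Qed.

Lemma swap_twice m n :
  \sum_(D <- animals d n.+2 | (m.+1 < nfull D)%N) w D =
  \sum_(D <- animals d n | (m <= nfull D)%N) w D *
    (rho * (npluggable D)%:R * (rho * (npluggable D).-1%:R) /
       ((nfull D).+2%:R * (nfull D).+1%:R)).
Proof.
rewrite swap_once.
have := swap_sum d1 (fun u v => (m < u)%N%:R / u%:R * (rho * v%:R / u.+1%:R)) n hsw => H.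
rewrite [RHS]big_mkcond [LHS]big_mkcond /=.
transitivity (\sum_(D <- animals d n.+1) w D * (nfull D)%:R *
  ((m < nfull D)%N%:R / (nfull D)%:R * (rho * (npluggable D)%:R / (nfull D).+1%:R))).
  apply: eq_bigr => D _; case: ltnP => h; last by rewrite !mul0r mulr0.
  have u0 : (nfull D)%:R != 0 :> R.
    by rewrite pnatr_eq0 -lt0n; apply: leq_ltn_trans h.
  by rewrite mul1r !mulrA mulfK.
rewrite -H; apply: eq_bigr => D _; rewrite ltnS.
case: leqP => _; rewrite ?mul0r ?mulr0 //.
by rewrite mul1r invfM; ring.
Qed.

(** With [t = a n.+1 / a n], summing [w D * (r D - t) ^ 2 >= 0] over the animals
    with many full tiles bounds [a n.+2] from below by [t ^ 2 * a n] up to the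
    negligible animals and the [O(1/n)] of [swap_rate_bounds]. *)
Lemma animal_ratio_limit : exp_rate a mu -> (fun n => a n.+1 / a n) @ \oo --> mu.
Proof.
move=> ra; have [mu0 _] := andP mu01.
have [L L0 Hdbl] := few_full_doubling.
pose bad n := \sum_(D <- animals d n | (nfull D < n %/ L)%N) w D.
have bad0 n : 0 <= bad n by apply: sumr_ge0.
have [C [C0 [N1 Hbad]]] := ratio_of_doubling mu01 ra L0 (fun n _ => Hdbl n).
have [N2 apos] := exp_rate_gt0 mu0 ra.
pose l : R := 2 * L%:R.
have l0 : 0 < l by rewrite mulr_gt0 // ltr0n.
pose D1 := rho ^+ 2 * l ^+ 2 * (l + 1).
have D10 : 0 <= D1 by rewrite !mulr_ge0 ?exprn_ge0 ?addr_ge0 // ltW.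
pose D2 := 2 * C * (2 * (rho * l)) ^+ 2 + D1.
have D20 : 0 <= D2.
  by rewrite addr_ge0 // mulr_ge0 ?exprn_ge0 ?mulr_ge0 // ltW.
pose N3 := (Num.truncn (2 * C)).+1.
apply: (@ratio_limit R a mu D2 (maxn (maxn N1 N2) (maxn N3 L)) mu0 ra D20) => n.
rewrite !geq_max => /andP[/andP[nN1 nN2] /andP[nN3 nL]].
have n0 : (0 < n)%N by apply: leq_trans nL.
have nR : 0 < n%:R :> R by rewrite ltr0n.
have an := apos n nN2; have an1 := apos n.+1 (leqW nN2).
set t := a n.+1 / a n.
have t0 : 0 < t by rewrite divr_gt0.
have tE : a n.+1 = t * a n by rewrite /t divfK // gt_eqF.
have -> : t * (a n.+2 / a n.+1) = a n.+2 / a n.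
  by rewrite /t; field; rewrite !gt_eqF.
pose K := (n.+1 %/ L)%N.
have K0 : (0 < K)%N by rewrite divn_gt0 // leqW.
(* A full tile is gained at each plug, so [m < u] at size n.+1 corresponds to
   [m <= u] at size n; [m.+1] is the threshold of [bad n.+1]. *)
pose m := K.-1; have mK : m.+1 = K by rewrite prednK.
have nK : (n <= 2 * L * K)%N.
  by apply: leq_trans (leqnSn n) _; apply: leq_twice_divM => //; exact: leqW.
pose r D : R := rho * (npluggable D)%:R / (nfull D).+1%:R.
have rb D : D \in animals d n -> (m <= nfull D)%N ->
    r D <= rho * l /\ r D ^+ 2 - D1 / n%:R <=
     rho * (npluggable D)%:R * (rho * (npluggable D).-1%:R) / ((nfull D).+2%:R * (nfull D).+1%:R).
  move=> /mem_animals[_ Dn] mD.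
  apply: (@swap_rate_bounds _ rho (nfull D) (npluggable D) n L K) => //; first by rewrite -mK.
  by rewrite -Dn; exact: card_pluggable.
pose F f := \sum_(D <- animals d n | (m <= nfull D)%N) w D * f D.
have F1 : F r = a n.+1 - bad n.+1.
  rewrite /F -swap_once; apply/eqP; rewrite eq_sym subr_eq; apply/eqP.
  rewrite /a (bigID (fun D => (m < nfull D)%N)) /= /bad; congr (_ + _).
  by apply: eq_bigl => D; rewrite -leqNgt -/K -mK ltnS.
have F2 : F (fun D => r D ^+ 2 - D1 / n%:R) <= a n.+2.
  apply: (@le_trans _ _ (\sum_(D <- animals d n.+2 | (m.+1 < nfull D)%N) w D)).
    rewrite swap_twice /F big_seq_cond [leRHS]big_seq_cond; apply: ler_sum => D.
    by move=> /andP[Dn mD]; rewrite ler_wpM2l //; have [_] := rb D Dn mD.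
  rewrite /a [leRHS](bigID (fun D => (m.+1 < nfull D)%N)) /= lerDl.
  exact: sumr_ge0.
have W1 : \sum_(D <- animals d n | (m <= nfull D)%N) w D <= a n.
  by rewrite /a [leRHS](bigID (fun D => (m <= nfull D)%N)) /= lerDl; exact: sumr_ge0.
have W0 : 0 <= \sum_(D <- animals d n | (m <= nfull D)%N) w D by apply: sumr_ge0.
set W := \sum_(D <- _ | _) _ in W1 W0.
have F3 : F r <= rho * l * W.
  rewrite /F /W mulr_sumr big_seq_cond [leRHS]big_seq_cond; apply: ler_sum => D.
  by move=> /andP[Dn mD]; rewrite mulrC ler_wpM2r //; have [] := rb D Dn mD.
have F4 : 2 * t * F r - t ^+ 2 * W - D1 / n%:R * W <= F (fun D => r D ^+ 2 - D1 / n%:R).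
  rewrite /F /W !mulr_sumr -!sumrB; apply: ler_sum => D _.
  have := mulr_ge0 (w0 D) (sqr_ge0 (r D - t)); nra.
have hb := Hbad n.+1 (leqW nN1); rewrite -/(bad _) in hb.
have hb1 : bad n.+1 <= C / n%:R * a n.+1.
  apply: (le_trans hb); apply: ler_wpM2r; first exact: ltW.
  apply: ler_wpM2l => //; by rewrite lef_pV2 ?posrE ?ltr0n // ler_nat.
have hb2 : C / n%:R <= 1 / 2.
  rewrite ler_pdivrMr //; suff : 2 * C <= n%:R by lra.
  by apply: (le_trans (ltW (truncnS_gt _))); rewrite ler_nat.
have D1n : 0 <= D1 / n%:R by rewrite divr_ge0 // ltW.
have Cn : 0 <= C / n%:R by rewrite divr_ge0 // ltW.
have rl : 0 < rho * l by rewrite mulr_gt0.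
have tb : t <= 2 * (rho * l).
  rewrite /t ler_pdivrMr //.
  have h1 : bad n.+1 <= 1 / 2 * a n.+1.
    by apply: (le_trans hb1); rewrite ler_wpM2r // ltW.
  have h2 : rho * l * W <= rho * l * a n by rewrite ler_wpM2l // ltW.
  by move: F3; rewrite F1; lra.
rewrite ler_pdivlMr //.
apply: le_trans F2; apply: le_trans F4; rewrite F1.
have D2E : D2 / n%:R = 2 * (C / n%:R) * (2 * (rho * l)) ^+ 2 + D1 / n%:R.
  by rewrite /D2; field; rewrite gt_eqF.
rewrite D2E.
have t2 : t ^+ 2 <= (2 * (rho * l)) ^+ 2.
  by rewrite lerXn2r // nnegrE ltW // mulr_gt0.
have g1 : t * bad n.+1 <= C / n%:R * t ^+ 2 * a n.
  have -> : C / n%:R * t ^+ 2 * a n = t * (C / n%:R * a n.+1) by rewrite tE; ring.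
  by rewrite ler_wpM2l // ltW.
have g2 : C / n%:R * t ^+ 2 * a n <= C / n%:R * (2 * (rho * l)) ^+ 2 * a n.
  by apply: ler_wpM2r; [exact: ltW | exact: ler_wpM2l].
have g3 : t ^+ 2 * W <= t ^+ 2 * a n by rewrite ler_wpM2l // exprn_ge0 // ltW.
have g4 : D1 / n%:R * W <= D1 / n%:R * a n by rewrite ler_wpM2l.
have g5 : 2 * t * a n.+1 = 2 * t ^+ 2 * a n by rewrite tE; ring.
rewrite mulrBr g5 !mulrBl mulrDl; lra.
Qed.

End AbstractRatio.

(** * Cylinder events and finite energy *)

Section Events.
Variables (R : realType) (d q : nat) (hq : (1 < q)%N).
Variable P : probability (Omega d hq) R.
Implicit Types (x y z : site d) (D S V : {fset site d}) (U : set (site d)).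
Local Notation Om := (Omega d hq).
Local Notation one := (state1 hq).

Definition pr (A : set Om) : R := fine (P A).

Lemma prE A : measurable A -> P A = (pr A)%:E.
Proof. by move=> mA; rewrite /pr fineK // fin_num_measure. Qed.

Lemma pr_ge0 A : 0 <= pr A.
Proof. exact: fine_ge0. Qed.

Lemma pr_le A B : measurable A -> measurable B -> A `<=` B -> pr A <= pr B.
Proof.
by move=> mA mB AB; rewrite -lee_fin -!prE //; apply: le_measure; rewrite ?inE.
Qed.

Lemma prU A B : measurable A -> measurable B -> A `&` B = set0 ->
  pr (A `|` B) = pr A + pr B.
Proof.
move=> mA mB AB; apply: EFin_inj; rewrite EFinD -!prE //; last exact: measurableU.
exact: measureU.
Qed.

Lemma events_on_sub U U' (A : set Om) : U `<=` U' -> events_on hq U A -> events_on hq U' A.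
Proof.
move=> UU'; apply: sub_sigma_algebra2 => B [x [s [Ux ->]]].
by exists x, s; split=> //; exact: UU'.
Qed.

Lemma events_on_measurable U (A : set Om) : events_on hq U A -> measurable A.
Proof. exact: events_on_sub. Qed.

Lemma events_onI U (A B : set Om) :
  events_on hq U A -> events_on hq U B -> events_on hq U (A `&` B).
Proof. exact: (@measurableI _ (g_sigma_algebraType (cylinders hq U))). Qed.

Lemma events_on_setT U : events_on hq U [set: Om].
Proof. exact: (@measurableT _ (g_sigma_algebraType (cylinders hq U))). Qed.

Lemma events_on_forall U S (Q : site d -> state hq -> Prop) :
  [set` S] `<=` U -> events_on hq U [set w : Om | forall z, z \in S -> Q z (w z)].
Proof.
move=> SU.
have -> : [set w : Om | forall z, z \in S -> Q z (w z)] =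
   \bigcap_(z in [set` S]) \bigcup_(s in [set s | Q z s]) [set w : Om | w z = s].
  apply/seteqP; split=> w /= wQ z zS; first by exists (w z) => //; exact: wQ.
  by have [s /= Qs ->] := wQ z zS.
apply: (@fin_bigcap_measurable _ (g_sigma_algebraType (cylinders hq U))) => // z zS.
apply: (@fin_bigcup_measurable _ (g_sigma_algebraType (cylinders hq U))).
  exact: finite_finset.
move=> s _; apply: sub_sigma_algebra; exists z, s; split=> //; exact: SU.
Qed.

Definition pattern S V : set Om :=
  [set w | (forall z, z \in S -> w z = one) /\ (forall z, z \in V -> w z <> one)].

Lemma pattern_events U S V : [set` S] `<=` U -> [set` V] `<=` U ->
  events_on hq U (pattern S V).
Proof.
move=> SU VU; apply: events_onI.
  exact: (@events_on_forall U _ (fun _ s => s = one)).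
exact: (@events_on_forall U _ (fun _ s => s <> one)).
Qed.

Lemma pattern_measurable S V : measurable (pattern S V).
Proof. by apply: (@events_on_measurable setT); exact: pattern_events. Qed.

(** Finite energy integrated over events off [x]: this form needs no version of
    a conditional probability and iterates over finitely many sites. *)
Definition insertion_tolerant (h : R) : Prop :=
  forall x (s : state hq) (A : set Om), events_on hq (~` [set x]) A ->
    h * pr A <= pr (A `&` [set w | w x = s]).

Lemma finite_energy_tolerant : finite_energy P ->
  exists h : R, 0 < h < 1 /\ insertion_tolerant h.
Proof.
move=> [h [h01 hfe]]; exists h; split=> // x s A eA.
have [f [[_ fi fA] hf _]] := hfe x s.
have mA := events_on_measurable eA.
have ms : measurable [set w : Om | w x = s].
  by apply: sub_sigma_algebra; exists x, s.
have hle w : h <= f w.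
  by rewrite -lee_fin; apply: (le_trans hf); apply: ereal_inf_lbound; exists w.
rewrite -lee_fin EFinM -!prE //; last exact: measurableI.
rewrite -fA // -integral_cst //.
have fiA : P.-integrable A (EFin \o f) by apply: integrableS fi.
apply: le_integral => //; first exact: finite_measure_integrable_cst.
by move=> w _; rewrite lee_fin.
Qed.

(** The sites of [T] are resampled one at a time: after prescribing the state of the
    first one, the event is still determined off the others. *)
Lemma tolerant_seq (h : R) (T : seq (site d)) (sg : site d -> state hq) (A : set Om) :
  0 < h ->
  insertion_tolerant h ->
  uniq T -> events_on hq (~` [set` T]) A ->
  h ^+ size T * pr A <= pr (A `&` [set w | forall z, z \in T -> w z = sg z]).
Proof.
move=> h0 hfe; elim: T A => [|x T IH] A /=.
  move=> _ _; rewrite expr0 mul1r.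
  by rewrite (_ : [set w | _] = setT) ?setIT //; apply/seteqP; split.
move=> /andP[xT uT] eA.
have eA1 : events_on hq (~` [set` T]) (A `&` [set w : Om | w x = sg x]).
  apply: events_onI.
    apply: events_on_sub eA => y /= yT yT'; apply: yT.
    by rewrite inE yT' orbT.
  by apply: sub_sigma_algebra; exists x, (sg x); split=> //=; exact/negP.
have -> : A `&` [set w : Om | forall z, z \in x :: T -> w z = sg z] =
   (A `&` [set w : Om | w x = sg x]) `&` [set w | forall z, z \in T -> w z = sg z].
  apply/seteqP; split=> w /=.
    move=> [Aw H]; split; first by split=> //; apply: H; rewrite inE eqxx.
    by move=> z zT; apply: H; rewrite inE zT orbT.
  move=> [[Aw wx] H]; split=> // z; rewrite inE => /orP[/eqP ->//|]; exact: H.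
apply: le_trans (IH _ uT eA1).
rewrite exprSr -mulrA ler_wpM2l ?exprn_ge0 ?(ltW h0) //.
apply: hfe.
apply: events_on_sub eA => y /= yT yx; apply: yT.
by rewrite yx inE eqxx.
Qed.

End Events.

(** * Clusters as cylinder events *)

Section ClusterEvents.
Variables (d q : nat) (hq : (1 < q)%N).
Implicit Types (x y z b : site d) (D S V X : {fset site d}).
Local Notation Om := (Omega d hq).
Local Notation one := (state1 hq).
Implicit Types w : Om.

Definition edge D : {fset site d} := ((\bigcup_(x <- D) nbr x) `\` D)%fset.

Lemma mem_edge D z : reflect (z \notin D /\ exists2 y, y \in D & adj y z) (z \in edge D).
Proof.
rewrite in_fsetD; apply: (iffP andP) => [[zD /bigfcupP[y]]|[zD [y yD yz]]].
  by rewrite andbT mem_nbr => yD yz; split=> //; exists y.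
by split=> //; apply/bigfcupP; exists y; rewrite ?yD // mem_nbr.
Qed.

Lemma occ_cluster_step w y z : occ_cluster w 0 y -> adj y z -> w z = one -> occ_cluster w 0 z.
Proof.
move=> [p [pp pl pw]] yz wz; exists (rcons p z).
rewrite rcons_path pp pl yz last_rcons -rcons_cons all_rcons pw andbT; split=> //; rewrite andbT.
exact/eqP.
Qed.

Lemma occ_cluster_occ w y : occ_cluster w 0 y -> w y = one.
Proof. by move=> [p [_ <- /allP pw]]; apply/eqP/(pw _ (mem_last _ _)). Qed.

Lemma occ_cluster0 w y : occ_cluster w 0 y -> occ_cluster w 0 0.
Proof. by move=> [p [_ _ /= /andP[w00 _]]]; exists [::]; rewrite /= w00. Qed.

Lemma occ_cluster_path w p : path (@adj d) 0 p -> all (occupied w) (0 :: p) ->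
  forall z, z \in 0 :: p -> occ_cluster w 0 z.
Proof.
elim/last_ind: p => [|p x IH].
  by move=> _ aw z; rewrite inE => /eqP ->; exists [::].
move=> pp aw z.
have := pp; have := aw; rewrite -rcons_cons all_rcons rcons_path.
move=> /andP[xw pw] /andP[pp' _].
rewrite mem_rcons inE => /orP[/eqP ->|]; last exact: IH.
by exists (rcons p x); rewrite last_rcons.
Qed.

Lemma occ_cluster_animal w D : occ_cluster w 0 = [set` D] -> (0 < #|` D|)%N -> animal D.
Proof.
move=> CD; rewrite cardfs_gt0 => /fset0Pn[y0 y0D].
have inD z : (occ_cluster w 0 z) <-> z \in D by rewrite CD.
split; first by apply/inD; apply: (@occ_cluster0 _ y0); exact/inD.
move=> y /inD [p [pp pl pw]]; exists p; split=> //.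
by apply/allP => z zp; apply/inD; exact: occ_cluster_path zp.
Qed.

Lemma occ_cluster_pattern D : animal D ->
  [set w : Om | occ_cluster w 0 = [set` D]] = @pattern d q hq D (edge D).
Proof.
move=> [D0 aD]; apply/seteqP; split=> w /=.
  move=> CD; have inD z : (occ_cluster w 0 z) <-> z \in D by rewrite CD.
  split=> z; first by move=> /inD; exact: occ_cluster_occ.
  move=> /mem_edge[zD [y /inD yD yz]] wz.
  by move/negP: zD; apply; apply/inD; exact: (occ_cluster_step yD yz wz).
move=> [wD wE]; apply/seteqP; split=> y /=.
  move=> [p [pp <- pw]] {y}.
  elim/last_ind: p pp pw => [|p z IH] //.
  rewrite rcons_path last_rcons -rcons_cons all_rcons => /andP[pp yz] /andP[/eqP wz pw].
  have := IH pp pw => yD; have [//|zD] := boolP (z \in D).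
  by exfalso; apply: (wE z) => //; apply/mem_edge; split=> //; exists (last 0 p).
move=> /aD [p [pp pl /allP pD]]; exists p; split=> //.
by apply/allP => z /pD /wD wz; apply/eqP.
Qed.

Variables (R : realType) (P : probability (Omega d hq) R).

Definition weight D : R := pr P [set w | occ_cluster w 0 = [set` D]].

Lemma weightE D : animal D -> weight D = pr P (@pattern d q hq D (edge D)).
Proof. by move=> aD; rewrite /weight occ_cluster_pattern. Qed.

Lemma weight_ge0 D : 0 <= weight D.
Proof. exact: pr_ge0. Qed.

Lemma card_nbr x : (#|` nbr x| <= #|` cube d 1|)%N.
Proof.
apply: (@leq_trans #|` [fset (x + z)%R | z in cube d 1]%fset|).
  apply: fsubset_leq_card; apply/fsubsetP => y; rewrite mem_nbr adj0B => /adj_cube1 yc.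
  by apply/imfsetP; exists (y - x) => //; rewrite addrC subrK.
exact: leq_imfset_card.
Qed.

(** It suffices to prescribe the states on the set [T] of the sites of the filled
    tiles and their neighbours, keeping the configuration elsewhere: the filled
    tiles become occupied, and their neighbours outside them vacant unless they
    belong to [D]. A site of the new boundary outside [T] has no neighbour in the
    filled tiles, so it was already in the boundary of [D]. *)
Lemma fill_energy (h : R) : 0 < h < 1 ->
  insertion_tolerant P h ->
  forall D X, animal D -> (X `<=` tiles D)%fset ->
   (h ^+ ((#|` cube d 1|).+1 * #|` cube d 1|)) ^+ #|` X| * weight D <=
     weight (D `|` cells X)%fset.
Proof.
move=> /andP[h0 h1] hfe D X aD XD.
set s := #|` cube d 1|.
have q0 : (0 < q)%N by apply: ltnW.
pose zero : state hq := Ordinal q0.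
have zero1 : zero <> one by move=> /(congr1 (@nat_of_ord q)).
pose D' := (D `|` cells X)%fset.
have aD' : animal D' by exact: fill_animal.
pose T := (\bigcup_(z <- cells X) (z |` nbr z))%fset.
have TX z : z \in cells X -> z \in T.
  by move=> zX; apply/bigfcupP; exists z; rewrite ?zX // !inE eqxx.
have TN y z : y \in cells X -> adj y z -> z \in T.
  by move=> yX yz; apply/bigfcupP; exists y; rewrite ?yX // in_fset1U mem_nbr yz orbT.
have Tcard : (#|` T| <= s.+1 * s * #|` X|)%N.
  apply: (@leq_trans (s.+1 * #|` cells X|)); last first.
    by rewrite -mulnA leq_mul2l card_cells orbT.
  rewrite /T; elim/finSet_rect: (cells X) => Y IH.
  have [->|[b bY]] := fset_0Vmem Y; first by rewrite big_seq_fset0 cardfs0.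
  rewrite (big_fsetD1 b) //= (cardfsD1 b Y) bY mulnDr muln1.
  apply: leq_trans (leq_card_fsetU _ _) _; apply: leq_add.
    apply: leq_trans (leq_card_fsetU _ _) _.
    by rewrite cardfs1 add1n ltnS card_nbr.
  by apply: IH; rewrite fproperD1.
pose A := @pattern d q hq (D `\` T)%fset (edge D `\` T)%fset.
pose sg z := if z \in D' then one else zero.
have eA : events_on hq (~` [set` T]) A.
  by apply: pattern_events => z /=; rewrite inE => /andP[/negP].
have mA := events_on_measurable eA.
have H := tolerant_seq sg h0 hfe (fset_uniq T) eA.
rewrite weightE // weightE //.
apply: (@le_trans _ _ (h ^+ size T * pr P A)).
  apply: ler_pM; [by rewrite !exprn_ge0 // ltW | exact: pr_ge0 | | ].
    by rewrite -exprM ler_wiXn2l // ltW.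
  apply: pr_le => //; first exact: pattern_measurable.
  by move=> w [wD wE]; split=> z; rewrite inE => /andP[_]; [exact: wD | exact: wE].
apply: (le_trans H); apply: pr_le.
- apply: measurableI => //.
  by apply: (@events_on_measurable _ _ _ setT);
  exact: (@events_on_forall _ _ _ setT T (fun z s => s = sg z)).
- exact: pattern_measurable.
move=> w [[wD wE] wT]; split=> z.
  move=> zD'; have [zT|zT] := boolP (z \in T); first by rewrite wT // /sg zD'.
  apply: wD; rewrite inE zT /=.
  by move: zD'; rewrite inE => /orP[//|/TX]; rewrite (negbTE zT).
move=> /mem_edge[zD' [y yD' yz]].
have [zT|zT] := boolP (z \in T); first by rewrite wT // /sg (negbTE zD').
apply: wE; rewrite inE zT /=; apply/mem_edge; split.
  by move: zD'; rewrite inE negb_or => /andP[].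
exists y => //; move: yD'; rewrite inE => /orP[//|yX].
by move: zT; rewrite (TN y z).
Qed.

(** The empty cluster is not an animal, hence [0 < n]. *)
Lemma size_eq_sum_weight n : (0 < n)%N ->
  measurable [set w : Om | (occ_cluster w 0 #= `I_n)%card] /\
  prob_size_eq P n = \sum_(D <- animals d n) weight D.
Proof.
move=> n0.
pose F D : set Om := [set w | occ_cluster w 0 = [set` D]].
have mF D : D \in animals d n -> measurable (F D).
  by move=> /mem_animals[aD _]; rewrite /F occ_cluster_pattern //; exact: pattern_measurable.
have FE : [set w : Om | (occ_cluster w 0 #= `I_n)%card] =
    \bigcup_(D in [set` animals d n]) F D.
  apply/seteqP; split=> w /=.
    move=> Cn; have Cf : finite_set (occ_cluster w 0) by apply/finite_setP; exists n.
    have CE := fset_setK Cf; have cE := card_fset_set Cn.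
    exists (fset_set (occ_cluster w 0)); last by rewrite /F /= CE.
    apply/mem_animals; split=> //.
    by apply: (@occ_cluster_animal w); rewrite ?CE // cE.
  by move=> [D /mem_animals[aD Dn]]; rewrite /F /= => ->; apply/card_eq_fsetP.
split.
  by rewrite FE; apply: fin_bigcup_measurable.
rewrite /prob_size_eq FE measure_fin_bigcup //; last first.
  move=> D D' _ _ [w [/= FD FD']]; apply/fsetP => z; apply/idP/idP => zD.
    by have : [set` D'] z by rewrite -FD' FD.
  by have : [set` D] z by rewrite -FD FD'.
rewrite -fsbig_seq ?fset_uniq //.
rewrite big_seq (eq_bigr (fun D => (weight D)%:E)) => [|D Dn].
  by rewrite -big_seq sumEFin.
by rewrite /weight -prE //; exact: mF.
Qed.

End ClusterEvents.

(** * Plugging multiplies the weight by a constant *)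

Section MarkovSwap.
Variables (R : realType) (d q : nat) (hq : (1 < q)%N).
Hypothesis d1 : (1 < d)%N.
Variable P : probability (Omega d hq) R.
Implicit Types (x y z b : site d) (D S V X : {fset site d}).
Local Notation Om := (Omega d hq).
Local Notation one := (state1 hq).
Local Notation pat := (@pattern d q hq).

Lemma pattern_translate x S V :
  translate x @^-1` pat S V =
    pat [fset (z + x)%R | z in S]%fset [fset (z + x)%R | z in V]%fset.
Proof.
apply/seteqP; split=> w /= [wS wV]; split=> z.
- by move=> /imfsetP[y /= yS ->]; exact: (wS y).
- by move=> /imfsetP[y /= yV ->]; exact: (wV y).
- by move=> zS; apply: wS; apply/imfsetP; exists z.
- by move=> zV; apply: wV; apply/imfsetP; exists z.
Qed.

Lemma imfset_nbr x : [fset (z + x)%R | z in nbr (0 : site d)]%fset = nbr x.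
Proof.
apply/fsetP => y; apply/imfsetP/idP => [[z /=]|].
  by rewrite !mem_nbr => z0 ->; rewrite -[x in adj x _]add0r adj_addr.
rewrite mem_nbr adj0B => yx; exists (y - x); rewrite ?subrK //=.
by rewrite mem_nbr.
Qed.

Hypothesis hinv : translation_invariant P.
Hypothesis hmarkov : boundary_markov P one.
Variable h : R.
Hypothesis h0 : 0 < h.
Hypothesis hfe : insertion_tolerant P h.

Definition occ_plug x := pat (x |` nbr x)%fset fset0.
Definition vac_plug x := pat (nbr x) [fset x]%fset.

Lemma pr_occ_plug x : pr P (occ_plug x) = pr P (occ_plug 0).
Proof.
rewrite /pr -[in RHS](hinv x); last exact: pattern_measurable.
rewrite pattern_translate imfset0; congr (fine (P (pat _ _))).
apply/fsetP => y; apply/idP/imfsetP => [|[z /=]].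
  rewrite in_fset1U => /orP[/eqP ->|yn].
    by exists 0; rewrite ?add0r //= !inE eqxx.
  have : (y \in [fset (z + x)%R | z in nbr (0 : site d)])%fset by rewrite imfset_nbr.
  by move=> /imfsetP[z /= zn ->]; exists z => //=; rewrite in_fset1U zn orbT.
rewrite !in_fset1U => /orP[/eqP -> ->|zn ->]; first by rewrite add0r eqxx.
apply/orP; right; rewrite -imfset_nbr; apply/imfsetP; by exists z.
Qed.

Lemma pr_vac_plug x : pr P (vac_plug x) = pr P (vac_plug 0).
Proof.
rewrite /pr -[in RHS](hinv x); last exact: pattern_measurable.
rewrite pattern_translate imfset_nbr; congr (fine (P (pat _ _))).
apply/fsetP => y; apply/idP/imfsetP => [|[z /=]].
  by rewrite inE => /eqP ->; exists 0; rewrite ?add0r //= inE.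
by rewrite !inE => /eqP -> ->; rewrite add0r.
Qed.

Lemma pattern_gt0 S V : [disjoint S & V]%fset -> 0 < pr P (pat S V).
Proof.
move=> SV.
have q0 : (0 < q)%N by apply: ltnW.
pose zero : state hq := Ordinal q0.
have zero1 : zero <> one by move=> /(congr1 (@nat_of_ord q)).
pose sg z := if z \in S then one else zero.
have := tolerant_seq sg h0 hfe (fset_uniq (S `|` V)%fset) (@events_on_setT d q hq _).
rewrite /pr probability_setT mulr1 -/(pr P _) setTI => H.
apply: lt_le_trans (le_trans H _); first by rewrite exprn_gt0.
apply: pr_le; last 1 first.
- move=> w wT; split=> z zz; rewrite wT ?inE ?zz ?orbT // /sg ?zz //.
  by rewrite (negbTE (fdisjointP_sym SV _ zz)).
- apply: (@events_on_measurable _ _ _ setT).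
  exact: (@events_on_forall _ _ _ setT (S `|` V)%fset (fun z s => s = sg z)).
- exact: pattern_measurable.
Qed.

Lemma occ_plug_gt0 x : 0 < pr P (occ_plug x).
Proof. by apply: pattern_gt0; exact: fdisjointX0. Qed.

Lemma vac_plug_gt0 x : 0 < pr P (vac_plug x).
Proof.
by apply: pattern_gt0; rewrite fdisjointX1 mem_nbr adj_irr.
Qed.

(** The only boundary site that plugging removes is the centre, and none is
    created, because all neighbours of the centre already belong to [D]. *)
Lemma edge_plug D b : b \in pluggable D -> edge D = (centre b |` edge (centre b |` D))%fset.
Proof.
rewrite mem_pluggable // => /andP[/fsubsetP bD bnD].
have nD z : adj (centre b) z -> z \in D by move=> /punctured_nbr/bD.
apply/fsetP => z; rewrite in_fset1U; apply/mem_edge/orP.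
  move=> [zD [y yD yz]]; have [->|zb] := eqVneq z (centre b); [by left|right].
  apply/mem_edge; split; first by rewrite in_fset1U negb_or zb.
  by exists y => //; rewrite in_fset1U yD orbT.
case=> [/eqP ->|/mem_edge[]].
  split=> //; have [z' cz' _] := centre_nbr d1 b.
  by exists z'; [exact: nD | rewrite adj_sym].
rewrite in_fset1U negb_or => /andP[zb zD] [y + yz].
rewrite in_fset1U => /orP[/eqP yb|yD]; last by split=> //; exists y.
by move: zD; rewrite nD // -yb.
Qed.

(** The clusters [D] and [D] with the centre [x] plugged are described by the same
    occupied neighbours [E] of [x] and the same far-away event [B], and differ only
    in the state of [x]. By the Markov property for the single site [x], given [E],
    the state of [x] is independent of [B]. *)
Lemma weight_plug D b : animal D -> b \in pluggable D ->
  weight P (centre b |` D)%fset =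
    pr P (occ_plug 0) / pr P (vac_plug 0) * weight P D.
Proof.
move=> aD bv; have aD' := plug_animal d1 aD bv.
rewrite !weightE // (edge_plug bv).
have := bv; rewrite mem_pluggable // => /andP[/fsubsetP bD bnD].
set x := centre b in bnD bD *; set D' := (x |` D)%fset.
have nD z : adj x z -> z \in D by move=> /punctured_nbr/bD.
have xE : x \notin edge D' by apply/negP => /mem_edge[]; rewrite !inE eqxx.
have nbE : nbr_boundary [set x] = [set` nbr x].
  apply/seteqP; split=> z /=.
    by move=> [y /= -> [/= xz _]]; rewrite mem_nbr.
  rewrite mem_nbr => xz; exists x => //; split=> //= zx.
  by move: xz; rewrite zx adj_irr.
pose E := pat (nbr x) fset0.
pose B := pat (D `\` nbr x)%fset (edge D').
have EE : [set w : Om | forall y, nbr_boundary [set x] y -> w y = one] = E.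
  by rewrite nbE; apply/seteqP; split=> w /=; [move=> H; split | move=> []].
have E0 : 0 < pr P E by apply: pattern_gt0; exact: fdisjointX0.
have eB : events_on hq (~` ([set x] `|` nbr_boundary [set x])) B.
  rewrite nbE; apply: pattern_events => z /=.
    rewrite in_fsetD => /andP[zn zD] [zx|]; last exact/negP.
    by move: bnD; rewrite -zx zD.
  move=> zE [zx|zn]; first by move: xE; rewrite -zx zE.
  move: zE => /mem_edge[+ _]; rewrite in_fset1U negb_or => /andP[_].
  by rewrite nD // -mem_nbr.
have markov A : events_on hq [set x] A ->
    pr P ((A `&` B) `&` E) * pr P E = pr P (A `&` E) * pr P (B `&` E).
  move=> eA; have := hmarkov (finite_set1 x) eA eB.
  rewrite EE /cond_prob -!/(pr P _) => H.
  move: (congr1 (fun r => r * pr P E * pr P E) H).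
  rewrite divfK ?gt_eqF // => ->.
  by field; rewrite gt_eqF.
have s1 : [set` [fset x]%fset] `<=` [set x] by move=> z /=; rewrite inE => /eqP.
have s0 : [set` (fset0 : {fset site d})] `<=` [set x] by move=> z /=; rewrite inE.
have M1 := markov _ (pattern_events s1 s0).
have M0 := markov _ (pattern_events s0 s1).
have in0 (z : site d) : z \in (fset0 : {fset site d}) -> False by rewrite inE.
have P1 : pat [fset x]%fset fset0 `&` E = occ_plug x.
  apply/seteqP; split=> w /=.
    move=> [[w1 _] [wE _]]; split=> [z|z /in0//].
    by rewrite in_fset1U => /orP[/eqP ->|/wE//]; apply: w1; rewrite inE.
  move=> [w1 _]; split; split=> [z zz|z /in0//]; apply: w1; rewrite in_fset1U ?zz ?orbT //.
  by move: zz; rewrite inE => ->.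
have P0 : pat fset0 [fset x]%fset `&` E = vac_plug x.
  apply/seteqP; split=> w /=.
    by move=> [[_ w1] [wE _]]; split.
  by move=> [wE w1]; split; split=> // z /in0.
have Q1 : (pat [fset x]%fset fset0 `&` B) `&` E = pat D' (edge D').
  apply/seteqP; split=> w /=.
    move=> [[[w1 _] [wB wE']] [wE _]]; split=> // z.
    rewrite in_fset1U => /orP[/eqP ->|zD]; first by apply: w1; rewrite inE.
    have [zn|zn] := boolP (z \in nbr x); first exact: wE.
    by apply: wB; rewrite in_fsetD zn.
  move=> [w1 w2]; split; first split; split=> // z.
  - by rewrite inE => /eqP ->; apply: w1; rewrite in_fset1U eqxx.
  - by rewrite in_fsetD => /andP[_ zD]; apply: w1; rewrite in_fset1U zD orbT.
  - by rewrite mem_nbr => /nD zD; apply: w1; rewrite in_fset1U zD orbT.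
have Q0 : (pat fset0 [fset x]%fset `&` B) `&` E = pat D (x |` edge D')%fset.
  apply/seteqP; split=> w /=.
    move=> [[[_ w1] [wB wE']] [wE _]]; split=> z.
      move=> zD; have [zn|zn] := boolP (z \in nbr x); first exact: wE.
      by apply: wB; rewrite in_fsetD zn.
    by rewrite in_fset1U => /orP[/eqP ->|/wE'//]; apply: w1; rewrite inE.
  move=> [w1 w2]; split; first split; split=> // z.
  - by rewrite inE => /eqP ->; apply: w2; rewrite in_fset1U eqxx.
  - by rewrite in_fsetD => /andP[_ zD]; apply: w1.
  - by move=> zE; apply: w2; rewrite in_fset1U zE orbT.
  - by rewrite mem_nbr => /nD zD; apply: w1.
rewrite P1 Q1 in M1; rewrite P0 Q0 in M0.
have v0 := vac_plug_gt0 x.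
rewrite -(pr_occ_plug x) -(pr_vac_plug x).
have E1 : pr P E != 0 by rewrite gt_eqF.
by apply: (mulIf E1); rewrite M1 -[RHS]mulrA M0; field; rewrite gt_eqF.
Qed.

End MarkovSwap.

(** * The tail of the cluster size *)

Section Tail.
Variables (R : realType) (d q : nat) (hq : (1 < q)%N).
Variable P : probability (Omega d hq) R.
Local Notation Om := (Omega d hq).
Let size_eq n := [set w : Om | (occ_cluster w 0 #= `I_n)%card].
Let size_ge n := [set w : Om | (`I_n #<= occ_cluster w 0)%card /\
   finite_set (occ_cluster w 0)].

Lemma size_ge_measurable n : (0 < n)%N -> measurable (size_ge n).
Proof.
move=> n0; have -> : size_ge n = \bigcup_(m in [set m | (n <= m)%N]) size_eq m.
  apply/seteqP; split=> w /=.
    move=> [nC /finite_setP[m Cm]]; exists m => //=.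
    by move: nC; rewrite (card_le_eqr Cm) card_le_II.
  move=> [m /= nm Cm]; split; last by apply/finite_setP; exists m.
  by rewrite (card_le_eqr Cm) card_le_II.
apply: bigcup_measurable => m /= nm.
by have [] := size_eq_sum_weight P (leq_trans n0 nm).
Qed.

Lemma size_ge_recl n : (0 < n)%N ->
  prob_size_ge_fin P n = prob_size_eq P n + prob_size_ge_fin P n.+1.
Proof.
move=> n0; rewrite /prob_size_ge_fin /prob_size_eq -!/(pr P _) -prU.
- congr pr; apply/seteqP; split=> w /=.
    move=> [nC Cf]; have [m Cm] := Cf; move: nC.
    rewrite (card_le_eqr Cm) card_le_II leq_eqVlt => /orP[/eqP nm|nm].
      by left; rewrite nm.
    by right; split=> //; rewrite (card_le_eqr Cm) card_le_II.
  move=> [Cn|[nC Cf]].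
    by split; [rewrite (card_le_eqr Cn) card_le_II | apply/finite_setP; exists n].
  by split=> //; apply: card_le_trans nC; rewrite card_le_II.
- by have [] := size_eq_sum_weight P n0.
- exact: size_ge_measurable.
- apply/seteqP; split=> w //= [Cn [nC _]].
  by move: nC; rewrite (card_le_eqr Cn) card_le_II ltnn.
Qed.

Lemma size_ge_cvg0 : prob_size_ge_fin P @ \oo --> 0.
Proof.
rewrite -cvg_shiftS.
have cap0 : \bigcap_n size_ge n.+1 = set0.
  apply/seteqP; split=> w //= Hw.
  have [_ [m Cm]] := Hw 0%N I; have [] := Hw m I.
  by rewrite (card_le_eqr Cm) card_le_II ltnn.
have : P \o (fun n => size_ge n.+1) @ \oo --> P (\bigcap_n size_ge n.+1).
  apply: nonincreasing_cvg_mu.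
  - by rewrite ltey_eq fin_num_measure //; exact: size_ge_measurable.
  - by move=> n; exact: size_ge_measurable.
  - by rewrite cap0.
  - move=> n m nm; apply/subsetPset => w /= [mC Cf]; split=> //.
    by apply: card_le_trans mC; rewrite card_le_II.
by rewrite cap0 measure0 => /fine_cvg.
Qed.

End Tail.

(** * The ratio limit theorem *)

Theorem corollary1p10 (R : realType) (d q : nat) (hd : (2 <= d)%N)
    (hq : (2 <= q)%N) (P : probability (Omega d hq) R) (mu : R)
    (hinv : translation_invariant P)
    (hfe : finite_energy P)
    (hmarkov : boundary_markov P (state1 hq))
    (hmu : 0 < mu <= 1)
    (hlim_eq : (fun n : nat => prob_size_eq P n `^ (n%:R^-1)) @ \oo --> mu)
    (hlim_ge :
      (fun n : nat => prob_size_ge_fin P n `^ (n%:R^-1)) @ \oo --> mu) :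
  (fun n : nat => prob_size_eq P n.+1 / prob_size_eq P n) @ \oo --> mu /\
  (fun n : nat => prob_size_ge_fin P n.+1 / prob_size_ge_fin P n) @ \oo
    --> mu.
Proof.
have [h [h01 hfe']] := finite_energy_tolerant hfe.
have /andP[h0 h1] := h01; have /andP[mu0 _] := hmu.
have aE n : (0 < n)%N -> prob_size_eq P n = \sum_(D <- animals d n) weight P D.
  by move=> n0; have [] := size_eq_sum_weight P n0.
have ra : exp_rate (prob_size_eq P) mu.
  by apply: exp_rate_root => // n; exact: fine_ge0.
have ra' : exp_rate (fun n => \sum_(D <- animals d n) weight P D) mu.
  move=> t /ra [N HN]; exists (maxn N 1) => n; rewrite geq_max => /andP[nN n0].
  by rewrite -aE //; exact: HN.
have c0 : 0 < h ^+ ((#|` cube d 1|).+1 * #|` cube d 1|) by rewrite exprn_gt0.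
have rho0 : 0 < pr P (@occ_plug d q hq 0) / pr P (@vac_plug d q hq 0).
  by rewrite divr_gt0 ?(occ_plug_gt0 h0 hfe') ?(vac_plug_gt0 h0 hfe').
have ratio : (fun n => prob_size_eq P n.+1 / prob_size_eq P n) @ \oo --> mu.
  have := animal_ratio_limit hd (weight_ge0 P) rho0 c0 hmu
    (weight_plug hd hinv hmarkov h0 hfe') (fill_energy h01 hfe') ra'.
  rewrite -cvg_shiftS -[X in _ -> X]cvg_shiftS /=.
  by under eq_fun do rewrite -!aE //.
split=> //.
have [N apos] := exp_rate_gt0 mu0 ra.
apply: (@tail_ratio_limit R (prob_size_eq P) (prob_size_ge_fin P) mu (maxn N 1)) => //.
- by move=> n; exact: fine_ge0.
- move=> n; rewrite geq_max => /andP[nN n0].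
  by split; [exact: apos | exact: size_ge_recl].
- exact: size_ge_cvg0.
Qed.
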